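(* Let $q$ be a prime power and let $n \geq 2$ be an integer. If the special unitary group $SU_{2n-1}(q)$ has a minimal logarithmic signature, then the projective special unitary group $PSU_{2n}(q)$ has a minimal logarithmic signature.
   Context: All groups are finite. For a finite group $G$, a logarithmic signature of $G$ is an ordered tuple $[A_1,\ldots,A_s]$ of subsets $A_i \subseteq G$ such that every element $g \in G$ can be written uniquely as a product $g = a_1a_2\cdots a_s$ with $a_i \in A_i$ for each $i$. Its length is $\sum_{i=1}^s |A_i|$. If $|G| = p_1^{\beta_1}\cdots p_k^{\beta_k}$ with $p_1,\ldots,p_k$ distinct primes and $\beta_j \ge 1$, every logarithmic signature has length at least $\sum_{j=1}^k \beta_j p_j$, and a logarithmic signature is called minimal (an MLS) if its length equals $\sum_{j=1}^k \beta_j p_j$. $SU_m(q)$ denotes the special unitary group of dimension $m$ over $GF(q^2)$ (isometries of determinant $1$ of a non-singular conjugate-symmetric sesquilinear form on $GF(q^2)^m$), and $PSU_m(q) = SU_m(q)/Z(SU_m(q))$. *)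

(* Defs.v *)
From mathcomp Require Import all_boot all_algebra all_fingroup all_solvable all_field.
Set Implicit Arguments. Unset Strict Implicit. Unset Printing Implicit Defensive.
Import GRing.Theory.

Open Scope group_scope.

Definition is_LS (gT : finGroupType) (G : {set gT}) (s : seq {set gT}) : Prop :=
  (forall i, (i < size s)%N -> nth set0 s i \subset G) /\
  (forall g, g \in G ->
     exists! t : (size s).-tuple gT,
       (forall i : 'I_(size s), tnth t i \in nth set0 s i) /\
       \prod_(x <- t) x = g).

Definition LS_length (gT : finGroupType) (s : seq {set gT}) : nat :=
  (\sum_(A <- s) #|A|)%N.

Definition MLS_bound (gT : finGroupType) (G : {set gT}) : nat :=
  (\sum_(p <- primes #|G|) logn p #|G| * p)%N.

Definition is_MLS (gT : finGroupType) (G : {set gT}) (s : seq {set gT}) : Prop :=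
  is_LS G s /\ LS_length s = MLS_bound G.

Definition has_MLS (gT : finGroupType) (G : {set gT}) : Prop :=
  exists s : seq {set gT}, is_MLS G s.

Close Scope group_scope.
Local Open Scope ring_scope.

(* conjugation of GF(q^2): the involutive field automorphism x |-> x^q *)
Definition qconj (F : finFieldType) (q : nat) (x : F) : F := x ^+ q.

(* H is the Gram matrix of a non-singular conjugate-symmetric sesquilinear
   form B(u,v) = u *m H *m (conj v)^T on row vectors of F^m *)
Definition nonsing_herm (F : finFieldType) (q m : nat) (H : 'M[F]_m) : Prop :=
  H^T = map_mx (qconj q) H /\ \det H != 0.

Definition SU (m : nat) (F : finFieldType) (q : nat) (H : 'M[F]_m.-1.+1)
  : {set {'GL_m[F]}} :=
  [set g : {'GL_m[F]} |
     (GLval g *m H *m (map_mx (qconj q) (GLval g))^T == H)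
     && (\det (GLval g) == 1)].

Arguments SU m {F} q H.

Definition PSU (m : nat) (F : finFieldType) (q : nat) (H : 'M[F]_m.-1.+1) :=
  ((SU m q H) / 'Z(SU m q H))%g.

Arguments PSU m {F} q H.

(* Main.v *)
From HB Require Import structures.
Require Import Defs.
From mathcomp Require Import all_boot all_algebra all_fingroup all_solvable all_field.
From mathcomp Require Import zify.
Set Implicit Arguments. Unset Strict Implicit. Unset Printing Implicit Defensive.
Import GRing.Theory VectorInternalTheory.

(* Let J be the hyperbolic form on F^n x F^n and G = SU(J), which is conjugate
   to SU(H2) because all non-singular hermitian forms of a given size over F are
   congruent.  Fix v0 = (c w, w) of norm 1, with w a basis vector.  The
   stabiliser of v0 in G is isomorphic to SU(H1), and
     G = Stab(v0) * E * {x^j | j < a} * {y_i | i < b} * <s>,   a b = q + 1,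
   where E is an abelian group of unipotent elements fixing the second
   component of a vector, and x, y_i, s lie in the Levi subgroup, the matrices of
   GL_n(F) with determinant in GF(q), acting on that component.  The last three factors are sharply transitive on F^n
   minus 0.  For this, identify F^n with the field of order q^(2n), let W be
   multiplication by a generator of its unit group, and put s = W^(q+1).  The
   powers of s have q + 1 orbits, and the determinant of W prevents it from
   lying in the Levi subgroup.  Let p be a prime divisor of n, and let K be the
   subfield of order q^(2n/p), generated by l = W^e with e = p mod q + 1.  As K
   is a proper subspace, matrices fixing K pointwise take all determinants, so
   both multiplication by l and W^i can be corrected to have determinant 1
   without changing the images l^j W^i of 1.  If p divides q + 1 take b = p,
   otherwise b = 1.  All factors but the first decompose into sets of prime size; the centre
   consists of scalars, which lie in <s>, so in the quotient it suffices to
   replace <s> by its image. *)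

(** * Signatures with prime-sized factors *)

Section Covers.
Local Open Scope group_scope.

Definition sum_prime_factors (N : nat) : nat :=
  (\sum_(p <- primes N) logn p N * p)%N.

(** Replaces the list of prime divisors by a common index range, on which the sums for two numbers
    and for their product are compared termwise. *)
Lemma sum_prime_factorsE N M : (0 < N)%N -> (N <= M)%N ->
  sum_prime_factors N = (\sum_(p < M.+1) logn p N * p)%N.
Proof.
move=> N0 NM; rewrite /sum_prime_factors.
rewrite -(big_mkord xpredT (fun p => logn p N * p)%N).
rewrite [RHS](bigID (fun p => p \in primes N)) /= [X in (_ + X)%N]big1 ?addn0; last first.
  move=> p; rewrite -logn_gt0 lt0n negbK => /eqP->; exact: mul0n.
rewrite -[RHS]big_filter; apply: perm_big; apply: uniq_perm.
- exact: primes_uniq.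
- by rewrite filter_uniq // iota_uniq.
move=> p; rewrite mem_filter mem_index_iota.
case: (boolP (p \in primes N)) => //=.
by rewrite mem_primes => /and3P[_ _ /(dvdn_leq N0) pN]; rewrite ltnS (leq_trans pN).
Qed.

Lemma sum_prime_factorsM N M : (0 < N)%N -> (0 < M)%N ->
  sum_prime_factors (N * M) = (sum_prime_factors N + sum_prime_factors M)%N.
Proof.
move=> N0 M0; rewrite (@sum_prime_factorsE N (N * M)) ?leq_pmulr //.
rewrite (@sum_prime_factorsE M (N * M)) ?leq_pmull //.
rewrite (@sum_prime_factorsE (N * M) (N * M)) ?muln_gt0 ?N0 // -big_split.
by apply: eq_bigr => p _; rewrite lognM // mulnDl.
Qed.

Lemma sum_prime_factors_prime p : prime p -> sum_prime_factors p = p.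
Proof.
by move=> pr; rewrite /sum_prime_factors primes_prime // big_seq1 logn_prime ?eqxx ?mul1n.
Qed.

Lemma sum_prime_factors1 : sum_prime_factors 1 = 0%N.
Proof. by rewrite /sum_prime_factors big_nil. Qed.

Variable gT : finGroupType.
Implicit Types (G A B : {set gT}) (s : seq ({set gT} * nat)) (N M p : nat).

(* [A] lies in a product of subsets of [G] whose sizes are bounded by numbers
   with product [N] and with the sum required of a minimal signature; once
   [A = G] and [N <= #|G|] all these bounds must be attained. *)
Definition covers G A N := exists s,
  [/\ all (fun Bc : {set gT} * nat => (Bc.1 \subset G) && (#|Bc.1| <= Bc.2)%N) s,
      A \subset \prod_(Bc <- s) Bc.1,
      (0 < N)%N /\ N = (\prod_(Bc <- s) Bc.2)%N
    & (\sum_(Bc <- s) Bc.2)%N = sum_prime_factors N].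

Lemma covers_weaken G G' A N : G \subset G' -> covers G A N -> covers G' A N.
Proof.
move=> GG' [s [sG sA sN sf]]; exists s; split=> //.
by apply: sub_all sG => Bc /andP[BG ->]; rewrite (subset_trans BG).
Qed.

Lemma covers_mul G A B N M : covers G A N -> covers G B M ->
  covers G (A * B) (N * M).
Proof.
move=> [s [sG sA [N0 sN] sf]] [t [tG tB [M0 tM] tf]]; exists (s ++ t); split.
- by rewrite all_cat sG.
- by rewrite big_cat /= mulgSS.
- by rewrite muln_gt0 N0 M0 big_cat /= -sN -tM.
by rewrite big_cat /= sf tf sum_prime_factorsM.
Qed.

Lemma covers_sub G A B N : A \subset B -> covers G B N -> covers G A N.
Proof.
by move=> AB [s [sG sA sN sf]]; exists s; split=> //; apply: subset_trans sA.
Qed.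

Lemma covers1 G : covers G 1 1.
Proof.
by exists [::]; split; rewrite ?big_nil ?sum_prime_factors1.
Qed.

Lemma covers_prime G A p : prime p -> A \subset G -> (#|A| <= p)%N -> covers G A p.
Proof.
move=> pr AG Ap; exists [:: (A, p)]; split; rewrite /= ?big_seq1 /= ?AG ?Ap //.
  by split; first exact: prime_gt0.
by rewrite sum_prime_factors_prime.
Qed.

(** A transversal of the cosets of [K] in [H] has prime size and supplies the extra factor. *)
Lemma covers_group_prime_sub G (H K : {group gT}) N : 
  H \subset G -> K \subset H -> prime #|H : K| -> covers G K N ->
  covers G H (N * #|H : K|).
Proof.
move=> HG KH pr cK; apply: covers_sub (covers_mul cK _);
  last apply: (@covers_prime _ [set repr C | C in rcosets K H] _ pr).
- apply/subsetP=> x xH.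
  have -> : x = (x * (repr (K :* x))^-1) * repr (K :* x) by rewrite mulgKV.
  apply: mem_mulg.
    by rewrite -mem_rcoset rcoset_sym mem_repr_rcoset.
  by apply/imsetP; exists (K :* x); rewrite // mem_rcosets mulSGid.
- apply: subset_trans HG; apply/subsetP=> x /imsetP[C /rcosetsP[y yH ->] ->].
  have /rcosetP[z zK ->] := mem_repr_rcoset K y.
  by rewrite groupM // (subsetP KH).
by apply: leq_imset_card.
Qed.

Lemma covers_solvable G (H : {group gT}) : H \subset G -> solvable H ->
  covers G H #|H|.
Proof.
have [m] := ubnP #|H|; elim: m H => // m IH H lt_m HG solH.
have [H1 | H1] := eqVneq (H : {set gT}) 1.
  by rewrite H1 cards1; apply: covers1.
have [K nK pr] := sol_prime_factor_exists solH H1.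
have KH := normal_sub nK.
rewrite -(Lagrange KH); apply: covers_group_prime_sub => //.
apply: IH; [| exact: subset_trans HG | exact: solvableS solH].
rewrite -ltnS; apply: leq_trans lt_m; rewrite ltnS.
by rewrite -(Lagrange KH) ltn_Pmulr ?prime_gt1.
Qed.

(** Dividing the exponent by [pdiv N] with remainder splits off the first [pdiv N] powers of [x] and
    leaves an interval of powers of [x ^+ pdiv N]. Powers may coincide, since [covers] only bounds
    sizes. *)
Lemma covers_interval (G : {group gT}) x N : x \in G -> (0 < N)%N ->
  covers G [set x ^+ i | i : 'I_N] N.
Proof.
have [m] := ubnP N; elim: m x N => // m IH x N lt_m xG N0.
have [N1 | N1] := leqP N 1.
  have -> : N = 1%N by apply/eqP; rewrite eqn_leq N1.
  apply: covers_sub (covers1 G); apply/subsetP=> y /imsetP[i _ ->].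
  by rewrite ord1 expg0 inE.
have pr := pdiv_prime N1; have dv := pdiv_dvd N.
rewrite -[X in covers _ _ X](divnK dv) mulnC.
have pG : covers G [set x ^+ i | i : 'I_(pdiv N)] (pdiv N).
  apply: covers_prime => //; last by rewrite (leq_trans (leq_imset_card _ _)) ?card_ord.
  by apply/subsetP=> y /imsetP[i _ ->]; rewrite groupX.
have lt1 : (N %/ pdiv N < N)%N by rewrite ltn_Pdiv ?prime_gt1.
have gt1 : (0 < N %/ pdiv N)%N by rewrite divn_gt0 ?prime_gt0 // dvdn_leq.
have cG := IH (x ^+ pdiv N) _ (leq_trans lt1 lt_m) (groupX _ xG) gt1.
apply: covers_sub (covers_mul pG cG); apply/subsetP=> y /imsetP[i _ ->].
have p0 : (0 < pdiv N)%N by rewrite prime_gt0.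
rewrite (divn_eq i (pdiv N)) addnC mulnC expgD expgM; apply: mem_mulg.
  by apply/imsetP; exists (Ordinal (ltn_pmod i p0)).
have lt2 : (i %/ pdiv N < N %/ pdiv N)%N by rewrite ltn_divLR // divnK.
by apply/imsetP; exists (Ordinal lt2).
Qed.

(** * From coverings to logarithmic signatures and back *)

Lemma prodsP (s : seq {set gT}) g :
  g \in \prod_(B <- s) B ->
  exists2 t : (size s).-tuple gT,
    (forall i, tnth t i \in nth set0 s i) & \prod_(x <- t) x = g.
Proof.
elim: s g => [|B s IH] g.
  by rewrite big_nil => /set1P->; exists [tuple]; [case | rewrite big_nil].
rewrite big_cons => /mulsgP[x y xB /IH[t tP <-] ->].
exists (cons_tuple x t); last by rewrite big_cons.
move=> i; case: (unliftP ord0 i) => [j ->|->] /=.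
  by rewrite tnthS.
by rewrite tnth0.
Qed.

Lemma mem_prods (s : seq {set gT}) (t : (size s).-tuple gT) :
  (forall i, tnth t i \in nth set0 s i) ->
  \prod_(x <- t) x \in \prod_(B <- s) B.
Proof.
elim: s t => [|B s IH] t tP; first by rewrite tuple0 !big_nil inE.
case/tupleP: t tP => x t tP; rewrite !big_cons mem_mulg //.
  by have := tP ord0; rewrite tnth0.
by apply: IH => i; have := tP (lift ord0 i); rewrite tnthS.
Qed.

Lemma leq_card_mulg (A B : {set gT}) : (#|(A * B)%g| <= #|A| * #|B|)%N.
Proof.
have -> : A * B = [set x * y | x in A, y in B] by [].
by rewrite curry_imset2X -cardsX leq_imset_card.
Qed.

Lemma leq_card_prods s (H : forall Bc, Bc \in s -> (#|Bc.1| <= Bc.2)%N) :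
  (#|(\prod_(Bc <- s) Bc.1)%g| <= \prod_(Bc <- s) Bc.2)%N.
Proof.
elim: s H => [|B s IH] H; rewrite ?big_nil ?cards1 // !big_cons.
rewrite (leq_trans (leq_card_mulg _ _)) // leq_mul ?H ?mem_head // IH // => C Cs.
by rewrite H // inE Cs orbT.
Qed.

(** A single strict inequality between a size and its bound would make the product of the sizes
    strictly smaller; positivity of the bounds permits the cancellation. *)
Lemma prod_bounds_tight s : (0 < \prod_(Bc <- s) Bc.2)%N ->
  (forall Bc, Bc \in s -> (#|Bc.1| <= Bc.2)%N) ->
  (\prod_(Bc <- s) Bc.2 <= \prod_(Bc <- s) #|Bc.1|)%N ->
  forall Bc, Bc \in s -> #|Bc.1| = Bc.2.
Proof.
elim: s => // B s IH; rewrite !big_cons muln_gt0 => /andP[B0 s0] le ge.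
have leB := le _ (mem_head _ _).
have les C : C \in s -> (#|C.1| <= C.2)%N by move=> Cs; rewrite le // inE Cs orbT.
have lep : (\prod_(Bc <- s) #|Bc.1| <= \prod_(Bc <- s) Bc.2)%N.
  by rewrite big_seq [leqRHS]big_seq leq_prod.
have eB : #|B.1| = B.2.
  apply/eqP; rewrite eqn_leq leB -(leq_pmul2r s0) (leq_trans ge) //.
  by rewrite leq_mul.
move=> C; rewrite inE => /orP[/eqP-> // | Cs]; apply: IH => //.
by rewrite -(leq_pmul2l B0); rewrite eB in ge.
Qed.

Definition factor_tuples (t : seq {set gT}) : {set (size t).-tuple gT} :=
  [set u : (size t).-tuple gT | [forall i, tnth u i \in nth set0 t i]].

Lemma factor_tuplesP (t : seq {set gT}) u :
  reflect (forall i, tnth u i \in nth set0 t i) (u \in factor_tuples t).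
Proof. by rewrite inE; apply: forallP. Qed.

Lemma card_factor_tuples (t : seq {set gT}) :
  #|factor_tuples t| = (\prod_(B <- t) #|B|)%N.
Proof.
pose F (i : 'I_(size t)) := nth set0 t i.
pose h (u : (size t).-tuple gT) := [ffun i => tnth u i].
have injh : injective h.
  by move=> u v /ffunP e; apply: eq_from_tnth => i; have := e i; rewrite !ffunE.
transitivity #|family F|.
  rewrite -(card_imset _ injh); apply: eq_card => x; apply/imsetP/familyP.
    by move=> [u /factor_tuplesP uT ->] i; rewrite ffunE.
  move=> xF; exists [tuple x i | i < size t].
    by apply/factor_tuplesP=> i; rewrite tnth_mktuple; apply: xF.
  by apply/ffunP=> i; rewrite ffunE tnth_mktuple.
by rewrite card_family foldrE big_map big_enum /= (big_nth set0) big_mkord.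
Qed.

(* A surjection between finite types of the same size is injective, which gives
   the uniqueness of the factorisations. *)
Lemma covers_has_MLS (G : {group gT}) N :
  covers G G N -> (N <= #|G|)%N -> has_MLS G.
Proof.
case=> s [sG sA [N0 EN] sf] NG; pose t := [seq Bc.1 | Bc <- s].
have le Bc : Bc \in s -> (#|Bc.1| <= Bc.2)%N by move=> /(allP sG)/andP[].
have pt : \prod_(B <- t) B = \prod_(Bc <- s) Bc.1 by rewrite big_map.
have ct : (\prod_(B <- t) #|B| = \prod_(Bc <- s) #|Bc.1|)%N by rewrite big_map.
have lep : (\prod_(Bc <- s) #|Bc.1| <= N)%N.
  by rewrite EN big_seq [leqRHS]big_seq leq_prod.
have gep : (#|G| <= \prod_(Bc <- s) #|Bc.1|)%N.
  rewrite (leq_trans (subset_leq_card sA)) // -pt -ct.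
  have := @leq_card_prods [seq (B, #|B|) | B <- t]; rewrite !big_map; apply.
  by move=> _ /mapP[B _ ->].
have EG : #|G| = N by apply/eqP; rewrite eqn_leq NG (leq_trans gep lep).
have eqc : forall Bc, Bc \in s -> #|Bc.1| = Bc.2.
  by apply: prod_bounds_tight; rewrite -?EN // -EG.
have EG' : (\prod_(B <- t) #|B|)%N = #|G|.
  by rewrite ct EG EN; apply: eq_big_seq.
exists t; split; last first.
  rewrite /LS_length big_map /MLS_bound EG -/(sum_prime_factors N) -sf.
  exact: eq_big_seq.
have tG i : nth set0 t i \subset G.
  have [lt_i | ge_i] := ltnP i (size t); last by rewrite nth_default ?sub0set.
  have /mapP[Bc Bs ->] := mem_nth set0 lt_i.
  by have /andP[] := allP sG _ Bs.
split=> // g gG.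
pose T := factor_tuples t.
pose f (u : (size t).-tuple gT) := \prod_(x <- u) x.
have surj x : x \in G -> exists2 u, u \in T & f u = x.
  move=> xG; have : x \in \prod_(B <- t) B by rewrite pt (subsetP sA).
  by case/prodsP=> u uT <-; exists u => //; apply/factor_tuplesP.
have injf : {in T &, injective f}.
  apply/imset_injP; rewrite eqn_leq leq_imset_card card_factor_tuples EG' subset_leq_card //.
  by apply/subsetP=> x /surj[u uT <-]; apply: imset_f.
have [u uT fu] := surj g gG; exists u; split.
  by split=> //; apply/factor_tuplesP.
move=> v [vT fv]; apply: injf; rewrite //; first by apply/factor_tuplesP.
by rewrite fu -fv.
Qed.

Lemma is_LS_card (G : {group gT}) t : is_LS G t -> #|G| = (\prod_(B <- t) #|B|)%N.
Proof.
case=> tG tP; rewrite -card_factor_tuples.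
pose f (u : (size t).-tuple gT) := \prod_(x <- u) x.
have fG u : u \in factor_tuples t -> f u \in G.
  move=> /factor_tuplesP uT; rewrite /f big_tuple; apply: group_prod => i _.
  by apply: (subsetP (tG _ (ltn_ord i))); apply: uT.
have injf : {in factor_tuples t &, injective f}.
  move=> u v uT vT fuv; have [w [_ wu]] := tP _ (fG u uT).
  by rewrite -(wu u) ?(wu v) //; split=> //; apply/factor_tuplesP.
rewrite -(card_in_imset injf); apply: eq_card => x.
apply/idP/imsetP=> [xG | [u uT ->]]; last exact: fG.
have [w [[wT fw] _]] := tP _ xG.
by exists w; [apply/factor_tuplesP | rewrite /f fw].
Qed.

Lemma is_LS_prods (G : {set gT}) t : is_LS G t -> G \subset \prod_(B <- t) B.
Proof.
case=> tG tP; apply/subsetP=> x /tP[w [[wT <-] _]]; exact: mem_prods.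
Qed.

Lemma has_MLS_covers (G H : {group gT}) : H \subset G -> has_MLS H -> covers G H #|H|.
Proof.
move=> HG [t [tLS tM]]; exists [seq (B, #|B|) | B <- t]; rewrite !big_map /=.
split.
- apply/allP=> _ /mapP[B Bt ->] /=; rewrite leqnn andbT (subset_trans _ HG) //.
  by have [/(_ _ _)] := tLS; rewrite -(nth_index set0 Bt) => -> //; rewrite index_mem.
- exact: is_LS_prods.
- by rewrite cardG_gt0 (is_LS_card tLS).
exact: tM.
Qed.

End Covers.

(** Sets do not grow under a morphism, so the old bounds stay valid even when [f] has a kernel. *)
Lemma covers_morphim (aT rT : finGroupType) (G H : {group aT})
    (f : {morphism H >-> rT}) (G' : {set rT}) (A : {set aT}) N :
  G \subset H -> (f @* G \subset G')%g -> covers G A N -> covers G' (f @* A)%g N.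
Proof.
move=> GH GG' [s [sG sA [N0 EN] sf]].
have sH Bc : Bc \in s -> Bc.1 \subset H.
  by move=> /(allP sG)/andP[BG _]; rewrite (subset_trans BG).
exists [seq ((f @* Bc.1)%g, Bc.2) | Bc <- s]; rewrite !big_map /=; split=> //.
  apply/allP=> _ /mapP[B Bs ->] /=; have /andP[BG Bc] := allP sG _ Bs.
  rewrite (subset_trans _ GG') ?morphimS //.
  by rewrite (leq_trans (leq_morphim _ _)).
apply: subset_trans (morphimS f sA) _.
elim: s sH {sG sA EN sf} => [|B s IH] sH; first by rewrite !big_nil morphim1.
rewrite !big_cons morphimMl ?mulgS ?IH ?sH ?mem_head // => C Cs.
by rewrite sH // inE Cs orbT.
Qed.

Local Open Scope ring_scope.

(** * Singer cycles *)

Lemma natr_card0 (F : finFieldType) : #|F|%:R = 0 :> F.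
Proof. by rewrite -FinRing.zmodXgE -cardsT expg_cardG ?inE. Qed.

(** [L] is the splitting field of ['X^m - 'X] with [m = #|F| ^ n]. The roots are the fixed points of
    the [n]-th power of the Frobenius automorphism, hence a subfield, hence all of [L]; as they are
    distinct, [L] has [m] elements. *)
Lemma finField_ext_exists (F : finFieldType) n : (0 < n)%N ->
  exists L : splittingFieldType F, dim L = n.
Proof.
move=> n_gt0; set m := (#|F| ^ n)%N.
have m_gt1: (m > 1)%N by rewrite (ltn_exp2l 0) ?finNzRing_gt1.
have m_gt0 := ltnW m_gt1; have m1_gt0: (m.-1 > 0)%N by rewrite -ltnS prednK.
pose q (R : nzRingType) : {poly R} := 'X^m - 'X.
have Dq (R : nzRingType) : q R = ('X^(m.-1) - 1) * ('X - 0).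
  by rewrite subr0 mulrBl mul1r -exprSr prednK.
have /FinSplittingFieldFor[/= L [zs DqL defL]]: q F != 0.
  by rewrite Dq monic_neq0 ?rpredM ?monicXsubC ?monicXnsubC.
rewrite rmorphB rmorphXn /= map_polyX -/(q L) in DqL; exists L.
pose K : finFieldType := FinFieldExtType L.
have Lm0 : m%:R = 0 :> L.
  by rewrite natrX -scaler_nat natr_card0 scale0r expr0n gtn_eqF.
have /finField_galois_generator[/= a _ Da]: (1 <= {:L})%VS by apply: sub1v.
pose Em := fixedSpace (a ^+ n)%g; rewrite dimv1 expn1 in Da.
(* [m] vanishes in [L], so [m.-1] is nonzero there and ['X^(m.-1) - 1] is separable; it does not
   have the root 0. *)
have Uzs: uniq zs.
  rewrite -separable_prod_XsubC -(eqp_separable DqL) Dq separable_root andbC.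
  rewrite /root !hornerE subr_eq0 eq_sym expr0n gtn_eqF ?oner_eq0 //=.
  rewrite cyclotomic.separable_Xn_sub_1 // -subn1 natrB // subr_eq0.
  by rewrite Lm0 eq_sym oner_eq0.
have cardK : #|K| = m.
  suffices /eq_card->: K =i zs.
    apply: succn_inj; rewrite (card_uniqP _) //= -(size_prod_XsubC _ id).
    by rewrite -(eqp_size DqL) size_polyDl size_polyXn // size_polyN size_polyX.
  have in_zs: zs =i Em.
    move=> z; rewrite -root_prod_XsubC -(eqp_root DqL) (sameP fixedSpaceP eqP).
    rewrite /root !hornerE subr_eq0 /= /m; congr (_ == z).
    elim: (n) => [|i IHi]; first by rewrite gal_id.
    by rewrite expgSr expnSr exprM IHi galM ?Da ?memvf.
  suffices defEm: Em = {:L}%VS by move=> z; rewrite in_zs defEm memvf.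
  apply/eqP; rewrite eqEsubv subvf -defL -[Em]subfield_closed agenvS //.
  by rewrite subv_add sub1v; apply/span_subvP=> z; rewrite in_zs.
have : #|K| = #|'rV[F]_(dim L)|.
  by apply: (bij_eq_card (f := @v2r _ L : K -> 'rV[F]_(dim L))); exists (@r2v _ L); [apply: v2rK | apply: r2vK].
rewrite cardK card_mx mul1n /m => /eqP.
by rewrite eqn_exp2l ?finNzRing_gt1 // => /eqP.
Qed.

Lemma expf_pred_card (K : finFieldType) (x : K) : x != 0 -> x ^+ #|K|.-1 = 1.
Proof.
by move=> x0; apply: (mulfI x0); rewrite -exprS prednK ?expf_card ?mulr1 // (cardD1 0).
Qed.

Lemma has_prim_root_finField (K : finFieldType) :
  exists w : K, (#|K|.-1).-primitive_root w.
Proof.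
have K1 : (0 < #|K|.-1)%N by rewrite -ltnS prednK ?finNzRing_gt1 // (cardD1 0).
have : has (#|K|.-1).-primitive_root (enum (predC1 (0 : K))).
  apply: has_prim_root => //.
  - by apply/allP=> x; rewrite mem_enum inE unity_rootE => /expf_pred_card->.
  - exact: enum_uniq.
  by rewrite -cardE cardC1.
by case/hasP=> w _; exists w.
Qed.

Section LinearMatrix.
Variables (R : comNzRingType) (m n : nat) (f : 'rV[R]_m -> 'rV[R]_n).
Hypothesis lin_f : linear f.
HB.instance Definition _ := GRing.isLinear.Build _ _ _ _ f lin_f.

Lemma lin1_mxE u : u *m lin1_mx f = f u.
Proof. exact: mul_rV_lin1. Qed.
End LinearMatrix.

(** In coordinates of the extension of degree [n], [W] is multiplication by a primitive element,
    [Phi] is the Frobenius map [x ^+ Q], and [w0] is the element 1. Powers of [Phi] single out the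
    subfields. *)
Lemma singer_matrix (F : finFieldType) n (Q := #|F|) : (0 < n)%N ->
  exists (W Phi : 'M[F]_n) (w0 : 'rV[F]_n),
  [/\ w0 != 0, W ^+ (Q ^ n).-1 = 1,
      forall k, w0 *m W ^+ k *m Phi = w0 *m W ^+ (k * Q),
      forall v, v != 0 -> exists k, v = w0 *m W ^+ k
    & forall k, w0 *m W ^+ k = w0 -> ((Q ^ n).-1 %| k)%N].
Proof.
move=> n0; have [L dimL] := finField_ext_exists F n0.
pose K : finFieldType := FinFieldExtType L.
subst n.
have cardK : #|K| = (Q ^ dim L)%N.
  rewrite -[dim L]mul1n -card_mx; apply: (bij_eq_card (f := @v2r _ L : K -> 'rV[F]_(dim L))).
  by exists (@r2v _ L); [apply: v2rK | apply: r2vK].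
have [w wP] : exists w : L, ((Q ^ dim L).-1).-primitive_root w.
  by rewrite -cardK; apply: (has_prim_root_finField K).
have linM a : linear (fun u : 'rV[F]_(dim L) => v2r (r2v u * a)).
  by move=> c u v; rewrite linearP mulrDl -scalerAl linearP.
have /finField_galois_generator[/= fr _ Dfr]: (1 <= {:L})%VS by apply: sub1v.
rewrite dimv1 expn1 in Dfr.
have linP : linear (fun u : 'rV[F]_(dim L) => v2r (fr (r2v u))).
  by move=> c u v; rewrite !linearP.
pose M a := lin1_mx (fun u : 'rV[F]_(dim L) => v2r (r2v u * a)).
have mulM x a : v2r x *m M a = v2r (x * a).
  by rewrite lin1_mxE //= v2rK.
pose Ph := lin1_mx (fun u : 'rV[F]_(dim L) => v2r (fr (r2v u))).
have mulPh x : v2r x *m Ph = v2r (x ^+ Q).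
  by rewrite lin1_mxE //= v2rK Dfr ?memvf.
have mx_inj (A B : 'M[F]_(dim L)) : (forall x, v2r x *m A = v2r x *m B) -> A = B.
  move=> AB; apply/row_matrixP=> i; rewrite !rowE -(r2vK (delta_mx 0 i)); exact: AB.
have mulMX x k : v2r x *m M w ^+ k = v2r (x * w ^+ k).
  elim: k x => [|k IH] x; first by rewrite !expr0 mulr1 mulmx1.
  by rewrite !exprS mulmxA mulM IH mulrA.
exists (M w), Ph, (v2r 1); split.
- by rewrite -(inj_eq (@r2v_inj _ L)) v2rK linear0 oner_eq0.
- by apply: mx_inj => x; rewrite mulMX (prim_expr_order wP) mulr1 mulmx1.
- by move=> k; rewrite !mulMX !mul1r mulPh exprM.
- move=> v v0; have r0 : r2v v != 0 :> L.
    by rewrite -(inj_eq (@v2r_inj _ L)) r2vK linear0.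
  have /(prim_rootP wP)[k e] : (r2v v : L) ^+ (Q ^ dim L).-1 = 1.
    by rewrite -cardK; apply: (@expf_pred_card K).
  by exists k; rewrite mulMX mul1r -e r2vK.
by move=> k; rewrite mulMX mul1r => /v2r_inj/eqP; rewrite -(prim_order_dvd wP).
Qed.

(** * A transitive product inside the Levi subgroup *)

(** One block matrix is factored into triangular matrices in two ways, and the determinants are
    compared. *)
Lemma det_1D_mulmx (F : fieldType) n (c : 'cV[F]_n) (r : 'rV[F]_n) :
  \det (1%:M + c *m r) = 1 + (r *m c) 0 0.
Proof.
have e1 : block_mx (1%:M : 'M_1) (- r) c 1%:M =
    block_mx (1%:M : 'M_1) 0 c 1%:M *m block_mx 1%:M (- r) 0 (1%:M + c *m r).
  by rewrite mulmx_block ?mul1mx ?mul0mx ?mulmx1 ?mulmx0 ?addr0 mulmxN addrCA addNr addr0.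
have e2 : block_mx (1%:M : 'M_1) (- r) c 1%:M =
    block_mx 1%:M (- r) 0 1%:M *m block_mx (1%:M + r *m c) 0 c 1%:M.
  rewrite mulmx_block ?mul1mx ?mul0mx ?mulmx1 ?mulmx0 ?add0r mulNmx.
  by rewrite addrK.
have := e1; rewrite e2 => /(congr1 determinant).
rewrite !det_mulmx !det_ublock !det_lblock !det1 !mul1r mulr1 => <-.
by rewrite det_mx11 !mxE eqxx.
Qed.

(** A rank-one perturbation of the identity built from a nonzero column of [N] fixes the kernel of
    [N]; rescaling its row factor gives any determinant. *)
Lemma exists_fix_ker_det (F : fieldType) n (N : 'M[F]_n) (d : F) : N != 0 ->
  exists2 T : 'M[F]_n, forall w : 'rV_n, w *m N = 0 -> w *m T = w & \det T = d.
Proof.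
move=> N0; have [i [j Nij]] : exists i j, N i j != 0.
  case: (pickP [pred ij | N ij.1 ij.2 != 0]) => [[i j] Nij | N00]; first by exists i, j.
  by case/eqP: N0; apply/matrixP=> i j; rewrite mxE; have /negbFE/eqP := N00 (i, j).
pose r : 'rV_n := ((d - 1) / N i j) *: delta_mx 0 i.
exists (1%:M + col j N *m r).
  move=> w wN; rewrite mulmxDr mulmx1 colE !mulmxA wN !mul0mx; exact: addr0.
rewrite det_1D_mulmx -scalemxAl -rowE !mxE -mulrA mulVf // mulr1.
by rewrite addrC subrK.
Qed.

Lemma sum_expn_mod x d n : x = 1 %[mod d] -> (\sum_(i < n) x ^ i)%N = n %[mod d].
Proof.
move=> x1; elim: n => [|n IH]; first by rewrite big_ord0.
rewrite big_ord_recr /= -modnDm IH -[(x ^ n %% d)%N]modnXm x1 modnXm exp1n modnDm addn1.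
by [].
Qed.

Lemma sqrn_mod1 q : q ^ 2 = 1 %[mod q.+1].
Proof.
case: q => // q; have -> : (q.+1 ^ 2 = q * q.+2 + 1)%N by rewrite expnS expn1; nia.
by rewrite modnMDl.
Qed.

Lemma dvdn_succ_card q n : (0 < q)%N -> (q.+1 %| (q ^ (2 * n)).-1)%N.
Proof.
move=> q0; rewrite expnM predn_exp dvdn_mulr //.
by rewrite -subn1 -eqn_mod_dvd ?expn_gt0 ?q0 // (sqrn_mod1 q).
Qed.

Lemma expn_gt1 q k : (1 < q)%N -> (0 < k)%N -> (1 < q ^ k)%N.
Proof. by move=> q1 k0; have := ltn_exp2l 0 k q1; rewrite k0 expn0. Qed.

(* Places the scalars of the special unitary group inside the powers of [W^(q+1)],
   since [N %/ q.+1] is congruent to [- 2 * n] modulo [q.+1]. *)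
Lemma levi_exponent q n k (N := (q ^ (2 * n)).-1) : (1 < q)%N -> (0 < n)%N ->
  (N %| k * q.+1)%N -> (N %| k * (2 * n))%N -> (q.+1 %| k)%N.
Proof.
move=> q1 n0; have q0 := ltnW q1.
pose G := (\sum_(i < n) (q ^ 2) ^ i)%N.
have EN : N = (q.+1 * (q.-1 * G))%N.
  rewrite /N expnM predn_exp -/G mulnA; congr (_ * _)%N; case: (q) q0 => // r _.
  by rewrite expnS expn1; nia.
have Gn : G = n %[mod q.+1] by apply: sum_expn_mod; rewrite sqrn_mod1.
have N1 : (1 < q ^ (2 * n))%N by rewrite expn_gt1 // muln_gt0.
have N0 : (0 < N)%N by rewrite /N -ltnS prednK // ltnW.
rewrite {1}EN mulnC dvdn_pmul2r // => /dvdnP[h Ek].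
have M0 : (0 < q.-1 * G)%N by move: N0; rewrite EN muln_gt0 => /andP[].
rewrite EN Ek mulnAC dvdn_pmul2r // => hd.
have hG : (q.+1 %| h * (2 * G))%N.
  have e : 2 * G = 2 * n %[mod q.+1] by rewrite -modnMmr Gn modnMmr.
  by rewrite /dvdn -modnMmr e modnMmr.
rewrite -(dvdn_addl _ hG) -mulnDr dvdn_mull // -mulnDl.
by case: (q) q1 => // r _; rewrite /= addn2 dvdn_mulr.
Qed.

(** If [p] divides [q.+1], this is division with remainder by [p]. Otherwise [p] is invertible
    modulo [q.+1], so its multiples alone reach every residue. The residues label the orbits of
    [W ^+ q.+1]. *)
Lemma levi_residue q p E : prime p -> E = p %[mod q.+1] ->
  exists a b : nat, [/\ (a * b)%N = q.+1, (b = 1 \/ prime b)%N &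
    forall k, exists (j : 'I_a) (i : 'I_b), (E * j + i)%N = k %[mod q.+1]].
Proof.
move=> pr Ep; have p0 := prime_gt0 pr.
have [pq | pq] := boolP (p %| q.+1)%N.
  exists (q.+1 %/ p)%N, p; split; [by rewrite divnK | by right|].
  have a0 : (0 < q.+1 %/ p)%N by rewrite divn_gt0 // dvdn_leq.
  move=> k; exists (Ordinal (ltn_pmod (k %/ p) a0)), (Ordinal (ltn_pmod k p0)) => /=.
  rewrite -modnDml -modnMml Ep modnMml (mulnC p) muln_modl (divnK pq).
  by rewrite modn_mod modnDml -divn_eq.
exists q.+1, 1%N; split; [by rewrite muln1 | by left|].
move=> k; have co : coprime p q.+1 by rewrite prime_coprime.
have [j Ej] : exists j, chinese p q.+1 0 k = (p * j)%N.
  have /eqP : chinese p q.+1 0 k = 0 %[mod p] by rewrite chinese_modl.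
  by rewrite mod0n => /dvdnP[j ->]; exists j; rewrite mulnC.
exists (Ordinal (ltn_pmod j (ltn0Sn q))), ord0 => /=.
by rewrite addn0 modnMmr -modnMml Ep modnMml -Ej chinese_modr.
Qed.

Lemma exists_unitmx_row (F : fieldType) n (u v : 'rV[F]_n) : u != 0 -> v != 0 ->
  exists2 C : 'M[F]_n, C \in unitmx & u *m C = v.
Proof.
move=> u0 v0.
have dec (w : 'rV[F]_n) : w != 0 -> exists2 a : F, a != 0 & w = a *: (pid_mx 1 *m row_ebase w).
  move=> w0; exists (col_ebase w 0 0).
    by have := col_ebase_unit w; rewrite unitmxE det_mx11 unitfE.
  rewrite -{1}(mulmx_ebase w) rank_rV w0 [col_ebase w]mx11_scalar.
  by rewrite -mulmxA mul_scalar_mx mxE eqxx.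
have [a a0 Eu] := dec u u0; have [b b0 Ev] := dec v v0.
exists ((b / a) *: (invmx (row_ebase u) *m row_ebase v)).
  rewrite unitmxZ ?unitfE ?mulf_neq0 ?invr_neq0 //.
  by rewrite unitmx_mul unitmx_inv !row_ebase_unit.
rewrite -scalemxAr {1}Eu -scalemxAl scalerA divfK // [RHS]Ev.
by rewrite -!mulmxA mulKVmx ?row_ebase_unit.
Qed.

Lemma det_expmx (R : comNzRingType) n (A : 'M[R]_n) k : \det (A ^+ k) = \det A ^+ k.
Proof. by elim: k => [|k IH]; rewrite ?expr0 ?det1 // !exprS det_mulmx IH. Qed.

Lemma expmx_conj (F : fieldType) n (C A : 'M[F]_n) k : C \in unitmx ->
  (C *m A *m invmx C) ^+ k = C *m A ^+ k *m invmx C.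
Proof.
move=> uC; elim: k => [|k IH]; first by rewrite !expr0 mulmx1 mulmxV.
by rewrite !exprS IH -!mulmxE -!mulmxA mulKmx.
Qed.

Lemma det_conj (F : fieldType) n (C A : 'M[F]_n) : C \in unitmx ->
  \det (C *m A *m invmx C) = \det A.
Proof.
by move=> uC; rewrite !det_mulmx mulrAC -det_mulmx mulmxV // det1 mul1r.
Qed.

Section Levi.
Variables (F : finFieldType) (q n : nat) (w1 : 'rV[F]_n).
Hypotheses (q_gt1 : (1 < q)%N) (cardF : #|F| = (q ^ 2)%N) (n_gt1 : (1 < n)%N).
Hypothesis w1_neq0 : w1 != 0.

(** Determinants fixed by the [q]-th power map lie in GF(q); this is the condition that gives the
    block matrix [levi_mx q A] determinant 1. *)
Definition det_in_base (A : 'M[F]_n) := (\det A != 0) && (\det A ^+ q == \det A).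

Let N := (q ^ (2 * n)).-1.
Let EN : N = (#|F| ^ n).-1. Proof. by rewrite cardF -expnM. Qed.

(* The condition [Y i = 1] at [i = 0] matters when [b = 1]: a factor with a single
   element is allowed in a minimal signature only if it can be dropped. *)
Lemma levi_factors_any : exists (w0 : 'rV[F]_n) (a b : nat) (X S : 'M[F]_n) (Y : 'I_b -> 'M[F]_n),
  [/\ w0 != 0, (a * b)%N = q.+1 /\ (b = 1 \/ prime b)%N,
      [/\ det_in_base X, det_in_base S, forall i, det_in_base (Y i)
        & forall i : 'I_b, i = 0 :> nat -> Y i = 1],
      S ^+ (N %/ q.+1) = 1 /\
      (forall c : F, c ^+ q.+1 = 1 -> c ^+ (2 * n) = 1 -> exists k, S ^+ k = c%:M)
    & forall v, v != 0 -> exists (j : 'I_a) (i : 'I_b) k,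
        v = w0 *m X ^+ j *m Y i *m S ^+ k].
Proof.
have n_gt0 := ltnW n_gt1; have q_gt0 := ltnW q_gt1.
have [W [Phi [w0 [w0_neq0]]]] := singer_matrix F n_gt0.
rewrite -EN => WN WPhi Wgen Wdvd.
have N0 : (0 < N)%N by rewrite /N -ltnS prednK ?expn_gt0 ?q_gt0 // expn_gt1 // muln_gt0.
have dW0 : \det W != 0.
  apply/eqP=> d0; have := congr1 determinant WN; rewrite det_expmx d0 det1 expr0n gtn_eqF // => /eqP.
  by rewrite eq_sym oner_eq0.
have uW : W \in unitmx by rewrite unitmxE unitfE.
pose p := pdiv n; pose m := (n %/ p)%N; have pr : prime p := pdiv_prime n_gt1.
have En : n = (m * p)%N by rewrite /m divnK // pdiv_dvd.
have m_gt0 : (0 < m)%N by rewrite divn_gt0 ?prime_gt0 // dvdn_leq // pdiv_dvd.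
(* [E] is the index of the unit group of the subfield of order [Qm], so [W ^+ E] is multiplication
   by a generator of that group. *)
pose Qm := (#|F| ^ m)%N; pose E := (\sum_(i < p) Qm ^ i)%N.
have QmE : (Qm.-1 * E)%N = N by rewrite -predn_exp -expnM -En.
have Q1 : #|F| = 1 %[mod q.+1] by rewrite cardF sqrn_mod1.
have Ep : E = p %[mod q.+1].
  by apply: sum_expn_mod; rewrite /Qm -modnXm Q1 modnXm exp1n.
have [a [b [ab bP abP]]] := levi_residue pr Ep.
have Qm1 : (1 < Qm)%N by rewrite expn_gt1 // finNzRing_gt1.
have WPhiX k l : w0 *m W ^+ k *m Phi ^+ l = w0 *m W ^+ (k * #|F| ^ l).
  elim: l => [|l IH]; first by rewrite expn0 muln1 expr0 mulmx1.
  by rewrite exprSr mulmxA IH WPhi expnSr mulnA.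
(* The kernel of [Z] is the subfield of order [Qm]. If [Z] were 0, then [w0 *m W ^+ Qm = w0 *m W]
   would force [N] to divide [Qm.-1], which is impossible as [E] exceeds 1. *)
pose Z := Phi ^+ m - 1.
have Z0 : Z != 0.
  apply/eqP=> Z0; have := WPhiX 1%N m; rewrite mul1n.
  have -> : Phi ^+ m = 1 by apply/eqP; rewrite -subr_eq0; apply/eqP.
  rewrite mulmx1 expr1 -/Qm -[in RHS](prednK (ltnW Qm1)) exprSr [in RHS]mulmxA.
  move/(can_inj (mulmxK uW))/esym/Wdvd; rewrite -QmE => /dvdn_leq.
  have Qm1' : (0 < Qm.-1)%N by rewrite -ltnS prednK // ltnW.
  move=> /(_ Qm1'); rewrite -{2}[Qm.-1]muln1 leq_pmul2l // leqNgt => /negP; apply.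
  have := prime_gt1 pr; rewrite /E; case: (p) => [|[|r]] // _.
  by rewrite !big_ord_recl /= expn0 ltnS addn_gt0 expn1 ltnW.
have kerZ k : w0 *m W ^+ (E * k) *m Z = 0.
  rewrite mulmxBr WPhiX -/Qm mulmx1.
  suff -> : (E * k * Qm = E * k + N * k)%N.
    by rewrite exprD (exprM W N k) WN expr1n mulr1 subrr.
  by rewrite -QmE -[in LHS](prednK (ltnW Qm1)); nia.
(* [TX] fixes the subfield pointwise, so [TX *m W ^+ E] still multiplies it by the generator, now
   with determinant 1. *)
have [TX TXfix dTX] := exists_fix_ker_det (\det W ^+ E)^-1 Z0.
have TYP (i : 'I_b) : exists T, (forall w : 'rV_n, w *m Z = 0 -> w *m T = w) /\
      \det T == (\det W ^+ i)^-1 /\ (i = 0 :> nat -> T = 1).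
  (* At index 0 the correction is taken to be the identity, as required for [Y i = 1] there. *)
  case: i => [[|i] lt_i].
    by exists 1%:M; split=> [w|]; rewrite ?mulmx1 // det1 expr0 invr1 eqxx.
  by have [T T1 T2] := exists_fix_ker_det (\det W ^+ i.+1)^-1 Z0;
    exists T; split=> //; split=> //; apply/eqP.
have /fin_all_exists[TY TYfix] := TYP.
have w0X k : w0 *m (TX *m W ^+ E) ^+ k = w0 *m W ^+ (E * k).
  elim: k => [|k IH]; first by rewrite muln0 !expr0.
  by rewrite exprSr mulmxA IH mulmxA TXfix ?kerZ // -mulmxA -[_ *m W ^+ E]exprD mulnS addnC.
have det1P (A : 'M[F]_n) : \det A = 1 -> det_in_base A.
  by rewrite /det_in_base => ->; rewrite expr1n oner_neq0 eqxx.
exists w0, a, b, (TX *m W ^+ E), (W ^+ q.+1), (fun i => TY i *m W ^+ i).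
split=> //.
- split; first by apply: det1P; rewrite det_mulmx dTX det_expmx mulVf // expf_neq0.
    (* The determinant of [W ^+ q.+1] is the norm of [\det W] from [F] to GF(q). *)
    rewrite /det_in_base det_expmx expf_neq0 //= -exprM; apply/eqP.
    rewrite mulSn exprD mulnn [in LHS]mulrC -cardF expf_card -exprS //.
    move=> i; apply: det1P; have [_ [/eqP dT _]] := TYfix i.
    by rewrite det_mulmx dT det_expmx mulVf // expf_neq0.
  by move=> i Ei; rewrite (TYfix i).2.2 // Ei expr0 mulmx1.
- split; first by rewrite -exprM mulnC divnK ?dvdn_succ_card.
  move=> c cq cn.
  have c0 : c != 0 by apply/eqP=> c0; move/eqP: cq; rewrite c0 expr0n eq_sym oner_eq0.
  have [k Ek] : exists k, c *: w0 = w0 *m W ^+ k.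
    by apply: Wgen; rewrite scaler_eq0 negb_or c0.
  (* Both sides agree at [w0] and commute with [W], whose powers carry [w0] to every nonzero
     vector. *)
  have EWk : W ^+ k = c%:M.
    apply/row_matrixP=> i; rewrite !rowE mul_mx_scalar.
    have [-> | /Wgen[l ->]] := eqVneq (delta_mx 0 i : 'rV[F]_n) 0.
      by rewrite mul0mx scaler0.
    by rewrite -mulmxA -[_ *m _ ^+ k]exprD addnC exprD mulmxA -Ek scalemxAl.
  have w0Wk l : w0 *m W ^+ (k * l) = c ^+ l *: w0.
    elim: l => [|l IH]; first by rewrite muln0 !expr0 mulmx1 scale1r.
    by rewrite mulnS exprD mulmxA -Ek -scalemxAl IH scalerA exprS.
  have kq : (N %| k * q.+1)%N by apply: Wdvd; rewrite w0Wk cq scale1r.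
  have kn : (N %| k * (2 * n))%N by apply: Wdvd; rewrite w0Wk cn scale1r.
  have /dvdnP[h Eh] := levi_exponent q_gt1 n_gt0 kq kn.
  by exists h; rewrite -exprM mulnC -Eh.
move=> v v0; have [k Ek] := Wgen v v0.
have [j [i Eji]] := abP k; exists j, i; set r := (E * j + i)%N in Eji.
(* The difference of [k] and [r] may be negative; adding [N * r] avoids this and changes neither the
   power of [W] nor the residue, because [q.+1] divides [N]. *)
have [l El] : exists l, (k + N * r = r + q.+1 * l)%N.
  have /dvdnP[l El] : (q.+1 %| k + N * r - r)%N.
    rewrite -eqn_mod_dvd; last by rewrite (leq_trans _ (leq_addl _ _)) // leq_pmull.
    have qN : (q.+1 %| N)%N := dvdn_succ_card n q_gt0.
    have [h Eh] := dvdnP qN; rewrite Eh.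
    by rewrite mulnAC addnC modnMDl Eji.
  exists l; rewrite (mulnC q.+1) -El subnKC //.
  by rewrite (leq_trans _ (leq_addl _ _)) // leq_pmull.
exists l; rewrite Ek w0X mulmxA (TYfix i).1 ?kerZ // -!mulmxA -[W ^+ i *m _]/(W ^+ i * _) -exprM -exprD.
rewrite -[W ^+ (E * j) *m _]exprD addnA -El exprD (exprM W N r) WN expr1n mulr1 //.
Qed.
(** Conjugation moves the base vector of the field model to the prescribed [w1] and preserves
    determinants and scalar matrices. *)
Lemma levi_factors : exists (a b : nat) (X S : 'M[F]_n) (Y : 'I_b -> 'M[F]_n),
  [/\ (a * b)%N = q.+1 /\ (b = 1 \/ prime b)%N,
      [/\ det_in_base X, det_in_base S, forall i, det_in_base (Y i)
        & forall i : 'I_b, i = 0 :> nat -> Y i = 1],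
      S ^+ (N %/ q.+1) = 1 /\
      (forall c : F, c ^+ q.+1 = 1 -> c ^+ (2 * n) = 1 -> exists k, S ^+ k = c%:M)
    & forall v, v != 0 -> exists (j : 'I_a) (i : 'I_b) k,
        v = w1 *m X ^+ j *m Y i *m S ^+ k].
Proof.
have [w0 [a [b [X [S [Y [w0_neq0 ab [dX dS dY Y1] [SN Sc] gen]]]]]]] := levi_factors_any.
have [C uC w1C] := exists_unitmx_row w1_neq0 w0_neq0.
have dconj A : det_in_base A -> det_in_base (C *m A *m invmx C).
  by rewrite /det_in_base det_conj.
exists a, b, (C *m X *m invmx C), (C *m S *m invmx C), (fun i => C *m Y i *m invmx C).
split=> //.
  split=> [||i|i i_0]; try exact: dconj.
  by rewrite Y1 // mulmx1 mulmxV.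
  split; first by rewrite expmx_conj // SN mulmx1 mulmxV.
  move=> c c1 c2; have [k Sk] := Sc c c1 c2; exists k.
  by rewrite expmx_conj // Sk mul_mx_scalar -scalemxAl mulmxV // scalemx1.
move=> v v0.
have [|j [i [k Ev]]] := gen (v *m C).
  by apply: contra_neq v0 => vC; rewrite -(mulmxK uC v) vC mul0mx.
exists j, i, k; rewrite !expmx_conj // !mulmxA w1C.
rewrite -(mulmxA _ (invmx C) C) mulVmx // mulmx1.
rewrite -(mulmxA _ (invmx C) C) mulVmx // mulmx1.
by rewrite -Ev mulmxK.
Qed.
End Levi.

(** * Hermitian forms over finite fields *)

Section Hermitian.
Variables (F : finFieldType) (q : nat).
Hypotheses (q_gt1 : (1 < q)%N) (cardF : #|F| = (q ^ 2)%N).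
Hypothesis q_pchar : [pchar F].-nat q.

Local Notation cj := (qconj q).

Lemma qconjK : involutive (cj : F -> F).
Proof. by move=> x; rewrite /qconj -exprM mulnn -cardF expf_card. Qed.

Fact qconj_is_zmod_morphism : zmod_morphism (cj : F -> F).
Proof. by move=> x y; rewrite /qconj exprDn_pchar // exprNn_pchar. Qed.

Fact qconj_is_monoid_morphism : monoid_morphism (cj : F -> F).
Proof. by split; [rewrite /qconj expr1n | move=> x y; rewrite /qconj exprMn]. Qed.

HB.instance Definition _ := GRing.isZmodMorphism.Build F F cj qconj_is_zmod_morphism.
HB.instance Definition _ := GRing.isMonoidMorphism.Build F F cj qconj_is_monoid_morphism.

Definition star m n (A : 'M[F]_(m, n)) : 'M_(n, m) := (map_mx cj A)^T.

Lemma starK m n : cancel (@star m n) (@star n m).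
Proof. by move=> A; apply/matrixP=> i j; rewrite !mxE qconjK. Qed.

Lemma starM m n p (A : 'M_(m, n)) (B : 'M_(n, p)) : star (A *m B) = star B *m star A.
Proof. by rewrite /star map_mxM trmx_mul. Qed.

Lemma star1 n : star (1%:M : 'M_n) = 1%:M.
Proof. by rewrite /star map_mx1 trmx1. Qed.

Lemma star0 m n : star (0 : 'M_(m, n)) = 0.
Proof. by rewrite /star map_mx0 trmx0. Qed.

Lemma starD m n (A B : 'M_(m, n)) : star (A + B) = star A + star B.
Proof. by rewrite /star map_mxD linearD. Qed.

Lemma starN m n (A : 'M_(m, n)) : star (- A) = - star A.
Proof. by rewrite /star map_mxN linearN. Qed.

Lemma starZ m n c (A : 'M_(m, n)) : star (c *: A) = cj c *: star A.
Proof. by rewrite /star map_mxZ linearZ. Qed.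

Lemma star_block m1 m2 n1 n2 (A : 'M_(m1, n1)) (B : 'M_(m1, n2))
    (C : 'M_(m2, n1)) (D : 'M_(m2, n2)) :
  star (block_mx A B C D) = block_mx (star A) (star C) (star B) (star D).
Proof. by rewrite /star map_block_mx tr_block_mx. Qed.

Lemma star_row_mx m n1 n2 (A : 'M_(m, n1)) (B : 'M_(m, n2)) :
  star (row_mx A B) = col_mx (star A) (star B).
Proof. by rewrite /star map_row_mx tr_row_mx. Qed.

Lemma star_inv n (A : 'M_n) : star (invmx A) = invmx (star A).
Proof. by rewrite /star map_invmx trmx_inv. Qed.

Lemma star_unit n (A : 'M_n) : (star A \in unitmx) = (A \in unitmx).
Proof. by rewrite /star unitmx_tr map_unitmx. Qed.

Lemma det_star n (A : 'M_n) : \det (star A) = cj (\det A).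
Proof. by rewrite /star det_tr det_map_mx. Qed.

Lemma nonsing_hermP n (H : 'M[F]_n) : nonsing_herm q H -> star H = H /\ \det H != 0.
Proof. by move=> [hH dH]; split=> //; rewrite /star -hH trmxK. Qed.

(** The polynomial ['X^q - c *: 'X] has degree [q], too small to vanish on all [q ^ 2] elements of
    [F]. *)
Lemma exists_qconj_neq (c : F) : exists x : F, cj x != c * x.
Proof.
apply/existsP; apply: contraT; rewrite negb_exists => /forallP H.
pose f : {poly F} := 'X^q - c *: 'X.
have sf : size f = q.+1.
  rewrite size_polyDl size_polyXn // size_polyN.
  by rewrite (leq_ltn_trans (size_scale_leq _ _)) // size_polyX ltnS.
have f0 : f != 0 by rewrite -size_poly_gt0 sf.
have := max_poly_roots f0 (rs := enum F); rewrite -cardE cardF sf enum_uniq.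
have -> : all (root f) (enum F).
  by apply/allP=> x _; rewrite rootE !hornerE subr_eq0; have := H x; rewrite negbK.
by move=> /(_ isT isT); nia.
Qed.

Lemma exists_trace1 : exists c : F, c + cj c = 1.
Proof.
have [x xP] := exists_qconj_neq (-1); exists (x / (x + cj x)).
have t0 : x + cj x != 0 by rewrite addrC addr_eq0 -mulN1r.
have ct : cj (x + cj x) = x + cj x by rewrite rmorphD /= qconjK addrC.
by rewrite rmorphM fmorphV /= ct -mulrDl divff.
Qed.

Lemma exists_skew : exists2 d : F, d != 0 & cj d = - d.
Proof.
have [x xP] := exists_qconj_neq 1; exists (cj x - x).
  by rewrite subr_eq0 -[x in _ == x]mul1r.
by rewrite rmorphB /= qconjK opprB.
Qed.

(** If [a] is the [k]-th power of a primitive element and is fixed by conjugation, then [q.+1]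
    divides [k]; the quotient is the exponent of [b]. *)
Lemma qnorm_surj (a : F) : a != 0 -> cj a = a -> exists b, b * cj b = a.
Proof.
move=> a0 ca; have [w wP] := has_prim_root_finField F.
have [k Ek] : exists k, a = w ^+ k.
  by have /(prim_rootP wP)[k ->] := expf_pred_card a0; exists k.
have E1 : (#|F|.-1 = q.-1 * q.+1)%N.
  by rewrite cardF; case: (q) q_gt1 => // r _; rewrite expnS expn1; nia.
have : (#|F|.-1 %| k * q.-1)%N.
  rewrite (prim_order_dvd wP) exprM -Ek; apply/eqP/(mulfI a0).
  by rewrite -exprS prednK ?(ltnW q_gt1) // mulr1.
rewrite E1 (mulnC k) dvdn_pmul2l; last by rewrite -ltnS prednK // ltnW.
case/dvdnP=> h Eh; exists (w ^+ h).
by rewrite /qconj -exprM -exprD -mulnS -Eh Ek.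
Qed.

(** Were all vectors isotropic, polarisation at a nonzero entry of [H] would make every trace
    [a + cj a] vanish, against the existence of an element of trace 1. The argument covers
    characteristic 2. *)
Lemma herm_nonisotropic n (H : 'M[F]_n) : star H = H -> H != 0 ->
  exists v : 'rV_n, (v *m H *m star v) 0 0 != 0.
Proof.
move=> hH H0; apply/existsP; apply: contraNT H0; rewrite negb_exists => /forallP iso.
have isoE (v : 'rV[F]_n) : (v *m H *m star v) 0 0 = 0 by apply/eqP; have := iso v; rewrite negbK.
apply/eqP/matrixP=> i j; rewrite mxE; apply/eqP; apply/contraT => Hij.
have tr0 (a : F) : a + cj a = 0.
  pose u : 'rV[F]_n := (a / H i j) *: delta_mx 0 i; pose w : 'rV[F]_n := delta_mx 0 j.
  have Euw : (u *m H *m star w) 0 0 = a.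
    rewrite -!scalemxAl -rowE mxE /star map_delta_mx trmx_delta -colE !mxE.
    by rewrite divfK.
  have addE (A B : 'M[F]_1) : (A + B) 0 0 = A 0 0 + B 0 0 by rewrite mxE.
  have := isoE (u + w); rewrite starD !mulmxDl !mulmxDr !addE !isoE add0r addr0 Euw.
  have -> : w *m H *m star u = star (u *m H *m star w).
    by rewrite !starM starK hH mulmxA.
  by rewrite [star _ 0 0]mxE mxE Euw.
by have [c] := exists_trace1; rewrite tr0 => /eqP; rewrite eq_sym oner_eq0.
Qed.

(** Gram-Schmidt: surjectivity of the norm rescales a non-isotropic vector to norm 1, and induction
    applies to its orthogonal complement. *)
Lemma herm_congr1 n (H : 'M[F]_n) : star H = H -> \det H != 0 ->
  exists2 P : 'M_n, P \in unitmx & P *m H *m star P = 1%:M.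
Proof.
elim: n H => [|n IH] H hH dH.
  by exists 1%:M; [apply: unitmx1 | apply/matrixP=> [[]]].
have H0 : H != 0 by apply: contraNneq dH => ->; rewrite det0.
have [u uH] := herm_nonisotropic hH H0.
set a := (_ : 'M_1) 0 0 in uH.
have ca : cj a = a.
  have -> : cj a = star (u *m H *m star u) 0 0 by rewrite [RHS]mxE mxE.
  by rewrite !starM starK hH mulmxA.
have [b Eb] : exists b, b * cj b = a^-1.
  by apply: qnorm_surj; rewrite ?invr_eq0 // fmorphV /= ca.
have vE : (b *: u) *m H *m star (b *: u) = 1%:M.
  rewrite starZ -!scalemxAl -scalemxAr scalerA Eb [_ *m star u]mx11_scalar -/a.
  by rewrite scale_scalar_mx mulVf.
have v0 : b *: u != 0.
  apply/eqP=> v0; move/matrixP/(_ 0 0): vE; rewrite v0 !mul0mx !mxE => /eqP.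
  by rewrite eq_sym oner_eq0.
have e0 : (row_mx (1%:M : 'M_1) 0 : 'rV[F]_(1 + n)) != 0.
  by apply/eqP=> /(congr1 lsubmx)/matrixP/(_ 0 0); rewrite row_mxKl linear0 !mxE eqxx => /eqP; rewrite oner_eq0.
have [C uC EC] := exists_unitmx_row e0 v0.
pose H' : 'M_(1 + n) := C *m H *m star C.
have hH' : star H' = H' by rewrite /H' !starM starK hH mulmxA.
pose r := ursubmx H'; pose D := drsubmx H'.
have EH' : H' = block_mx 1%:M r (star r) D.
  rewrite -{1}(submxK H'); congr block_mx.
    rewrite -vE -EC starM.
    have -> : row_mx 1%:M 0 *m C *m H *m (star C *m star (row_mx (1%:M : 'M_1) 0)) =
        row_mx 1%:M 0 *m H' *m star (row_mx (1%:M : 'M_1) (0 : 'M_(1, n))).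
      by rewrite /H' !mulmxA.
    rewrite star_row_mx star1 star0 -[in RHS](submxK H') mul_row_block mul_row_col.
    by rewrite !mul1mx !mul0mx !addr0 mulmx1 mulmx0 addr0.
  have : dlsubmx (star H') = star (ursubmx H') by apply/matrixP=> i j; rewrite !mxE.
  by rewrite hH'.
(* [L] clears the first row and column and leaves the Schur complement [D - star r *m r]. *)
pose L : 'M_(1 + n) := block_mx 1%:M 0 (- star r) 1%:M.
have uL : L \in unitmx by rewrite unitmxE det_lblock !det1 mul1r unitr1.
have EL : L *m H' *m star L = block_mx 1%:M 0 0 (D - star r *m r).
  rewrite EH' /L star_block star0 !star1 starN starK !mulmx_block.
  rewrite !mul1mx ?mul0mx !mulmx1 !mulmx0 ?addr0 ?mul0mx ?addr0. 
  by rewrite mul1mx !addNr mul0mx add0r mulNmx addrC.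
have uLC : L *m C \in unitmx by rewrite unitmx_mul uL.
have ELC : (L *m C) *m H *m star (L *m C) = block_mx 1%:M 0 0 (D - star r *m r).
  by rewrite -EL starM /H' !mulmxA.
have hD : star (D - star r *m r) = D - star r *m r.
  rewrite starD starN starM starK; congr (_ - _).
  by have := hH'; rewrite EH' star_block => /eq_block_mx[].
have dD : \det (D - star r *m r) != 0.
  have := congr1 determinant ELC; rewrite det_ublock det1 mul1r => <-.
  rewrite 2!det_mulmx det_star !mulf_neq0 // ?fmorph_eq0 -?unitfE -unitmxE //.
have [P uP EP] := IH _ hD dD.
have uB : (block_mx 1%:M 0 0 P : 'M_(1 + n)) \in unitmx.
  by rewrite unitmxE det_ublock det1 mul1r -unitmxE.
exists (block_mx 1%:M 0 0 P *m (L *m C)); first by rewrite unitmx_mul uLC andbT.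
rewrite starM; move: (L *m C) ELC => M EM.
transitivity (block_mx 1%:M 0 0 P *m (M *m H *m star M) *m star (block_mx (1%:M : 'M_1) 0 0 P)).
  by rewrite !mulmxA.
rewrite EM star_block !star0 star1 !mulmx_block.
rewrite !mul1mx !mul0mx !mulmx1 !mulmx0 !addr0 !add0r EP mul0mx.
exact: esym (@scalar_mx_block F 1 n 1).
Qed.

Lemma herm_congr n (H H' : 'M[F]_n) : star H = H -> \det H != 0 ->
  star H' = H' -> \det H' != 0 ->
  exists2 P : 'M_n, P \in unitmx & P *m H *m star P = H'.
Proof.
move=> hH dH hH' dH'; have [P uP EP] := herm_congr1 hH dH.
have [R uR ER] := herm_congr1 hH' dH'.
exists (invmx R *m P); first by rewrite unitmx_mul unitmx_inv uR.
rewrite starM; transitivity (invmx R *m (P *m H *m star P) *m star (invmx R)).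
  by rewrite !mulmxA.
by rewrite EP -ER star_inv !mulmxA mulVmx // mul1mx mulmxK ?star_unit.
Qed.
End Hermitian.

(** * The hyperbolic unitary group *)

Section HyperbolicUnitary.
Variables (F : finFieldType) (q n : nat).
Hypotheses (q_gt1 : (1 < q)%N) (cardF : #|F| = (q ^ 2)%N).
Hypothesis q_pchar : [pchar F].-nat q.
Variable i0 : 'I_n.

Local Notation cj := (qconj q).
Local Notation star := (star q).

Let cjK := qconjK cardF.
Let starK := @starK _ _ cardF.
Let starN := @starN _ _ q_pchar.
Let starD := @starD _ _ q_pchar.
Let starB m k (A B : 'M[F]_(m, k)) : star (A - B) = star A - star B.
Proof. by rewrite starD starN. Qed.
Let starM := @starM _ _ q_pchar.
Let star0 := @star0 _ _ q_pchar.
Let star1 := @star1 _ _ q_pchar.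
Let starZ := @starZ _ _ q_pchar.

Definition hypJ : 'M[F]_(n + n) := block_mx 0 1%:M 1%:M 0.

Definition in_SU k (H M : 'M[F]_k) := (M *m H *m star M == H) && (\det M == 1).

Lemma star_hypJ : star hypJ = hypJ.
Proof. by rewrite star_block !star0 !star1. Qed.

(** Matrices act on row vectors from the right, so this sends [row_mx x y] to
    [row_mx (x + y *m S) y]. *)
Definition low_unip (S : 'M[F]_n) : 'M[F]_(n + n) := block_mx 1%:M 0 S 1%:M.
Definition up_unip (S : 'M[F]_n) : 'M[F]_(n + n) := block_mx 1%:M S 0 1%:M.
(** The upper block is forced by preservation of [hypJ] once [A] acts on the second component. *)
Definition levi_mx (A : 'M[F]_n) : 'M[F]_(n + n) := block_mx (invmx (star A)) 0 0 A.

Lemma low_SU S : S + star S = 0 -> in_SU hypJ (low_unip S).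
Proof.
move=> S0; rewrite /in_SU det_lblock !det1 mulr1 eqxx andbT star_block star0 !star1.
rewrite !mulmx_block !mul1mx ?mul0mx !mulmx1 ?mulmx0 ?addr0 ?add0r ?mul1mx ?mul0mx ?add0r ?addr0.
by rewrite (addrC (star S)) S0.
Qed.

Lemma up_SU S : S + star S = 0 -> in_SU hypJ (up_unip S).
Proof.
move=> S0; rewrite /in_SU det_ublock !det1 mulr1 eqxx andbT star_block star0 !star1.
rewrite !mulmx_block ?mul1mx ?mul0mx ?mulmx1 ?mulmx0 ?addr0 ?add0r ?mul1mx ?mul0mx ?add0r ?addr0.
by rewrite S0.
Qed.

Lemma det_in_base_unit A : det_in_base q A -> (A : 'M[F]_n) \in unitmx.
Proof. by case/andP=> A0 _; rewrite unitmxE unitfE. Qed.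

Lemma lev_SU A : det_in_base q A -> in_SU hypJ (levi_mx A).
Proof.
move=> dA; have uA := det_in_base_unit dA; case/andP: dA => dA0 /eqP dA.
rewrite /in_SU det_ublock det_inv (det_star q_pchar) [cj _]dA mulVf // eqxx andbT.
rewrite star_block !star0 (star_inv q_pchar) starK.
rewrite !mulmx_block ?mul1mx ?mul0mx ?mulmx1 ?mulmx0 ?addr0 ?add0r ?mul1mx ?mul0mx ?add0r ?addr0.
by rewrite mulmxV // mulVmx ?star_unit.
Qed.

Lemma levM A B : A \in unitmx -> B \in unitmx -> levi_mx (A *m B) = levi_mx A *m levi_mx B.
Proof.
move=> uA uB; rewrite mulmx_block !mulmx0 !mul0mx !addr0 !add0r /levi_mx starM.
congr block_mx; have uBA: star B *m star A \in unitmx by rewrite unitmx_mul !star_unit // uB.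
rewrite -[LHS]mul1mx; apply: (canLR (mulmxK uBA)).
rewrite !mulmxA -(mulmxA _ (invmx _) (star B)) mulVmx ?star_unit // mulmx1.
by rewrite mulVmx ?star_unit.
Qed.

Lemma lev1 : levi_mx 1%:M = 1%:M.
Proof. by rewrite /levi_mx star1 invmx1 -scalar_mx_block. Qed.

Lemma levX A k : A \in unitmx -> levi_mx (A ^+ k) = levi_mx A ^+ k.
Proof.
move=> uA; elim: k => [|k IH]; first by rewrite !expr0 lev1.
by rewrite !exprS levM ?IH // unitmxE det_expmx unitrX // -unitmxE.
Qed.

Lemma lev_scalar (c : F) : c * cj c = 1 -> levi_mx c%:M = c%:M.
Proof.
move=> cc; rewrite /levi_mx; have -> : star c%:M = (cj c)%:M :> 'M_n by rewrite -scalemx1 starZ star1 scalemx1.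
rewrite invmx_scalar; have -> : (cj c)^-1 = c.
  have c0 : cj c != 0 by apply: contra_eq_neq cc => ->; rewrite mulr0 eq_sym oner_neq0.
  by apply: (mulIf c0); rewrite mulVf.
by rewrite -scalar_mx_block.
Qed.

Lemma det_in_baseM A B : det_in_base q (A : 'M[F]_n) -> det_in_base q B -> det_in_base q (A *m B).
Proof.
move=> /andP[a0 /eqP a1] /andP[b0 /eqP b1].
by rewrite /det_in_base det_mulmx mulf_neq0 //= exprMn a1 b1.
Qed.

Lemma det_in_baseX A k : det_in_base q (A : 'M[F]_n) -> det_in_base q (A ^+ k).
Proof.
move=> /andP[a0 /eqP a1].
by rewrite /det_in_base det_expmx expf_neq0 //= -exprM mulnC exprM a1.
Qed.

(* The antihermitian matrix supported on row and column [i0] whose row [i0] is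
   [r]; it is antihermitian only when [r 0 i0] is. *)
Definition skew_arm_mx (r : 'rV[F]_n) : 'M[F]_n :=
  \matrix_(i, j) if i == i0 then r 0 j else if j == i0 then - cj (r 0 i) else 0.

Definition skew_row (r : 'rV[F]_n) := r 0 i0 + cj (r 0 i0) == 0.

Lemma skewP r : skew_row r -> skew_arm_mx r + star (skew_arm_mx r) = 0.
Proof.
move=> /eqP r0; apply/matrixP=> i j; rewrite !mxE.
have cjN := exprNn_pchar _ q_pchar; have cj0 : cj (0 : F) = 0 by rewrite /qconj expr0n gtn_eqF // ltnW.
case: (eqVneq i i0) => [Ei|ni]; case: (eqVneq j i0) => [Ej|nj] //; rewrite ?Ei ?Ej //.
- by rewrite [cj (- _)]cjN -/(cj _) cjK subrr.
- by rewrite addNr.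
by rewrite cj0 addr0.
Qed.

Lemma skewD r r' : skew_arm_mx (r + r') = skew_arm_mx r + skew_arm_mx r'.
Proof.
apply/matrixP=> i j; rewrite !mxE; case: eqP => // _; case: eqP => _; last by rewrite addr0.
by rewrite /qconj exprDn_pchar // opprD.
Qed.

Lemma skew_rowD r r' : skew_row r -> skew_row r' -> skew_row (r + r').
Proof.
rewrite /skew_row => /eqP r0 /eqP r0'.
by rewrite mxE /qconj exprDn_pchar // addrACA [X in X + _]r0 [X in _ + X]r0' addr0.
Qed.

Lemma skew0 : skew_arm_mx 0 = 0.
Proof. by have /eqP := skewD 0 0; rewrite addr0 -subr_eq subrr => /eqP. Qed.

Lemma skew_row0 : skew_row 0.
Proof. by rewrite /skew_row mxE add0r /qconj expr0n gtn_eqF // ltnW. Qed.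

Lemma lowD S S' : low_unip (S + S') = low_unip S *m low_unip S'.
Proof.
by rewrite mulmx_block !mul1mx !mulmx1 ?mulmx0 ?mul0mx ?addr0 ?add0r addrC.
Qed.

Let w1 : 'rV[F]_n := delta_mx 0 i0.

Lemma mul_w1_skew r : w1 *m skew_arm_mx r = r.
Proof. by rewrite -rowE; apply/rowP=> j; rewrite !mxE eqxx. Qed.

Lemma w1_neq0 : w1 != 0.
Proof. by apply/eqP=> /rowP/(_ i0); rewrite !mxE !eqxx => /eqP; rewrite oner_eq0. Qed.

Variable c : F.
Hypothesis c_trace1 : c + cj c = 1.

Definition v0 : 'rV[F]_(n + n) := row_mx (c *: w1) w1.

Lemma row_hypJ (x y : 'rV[F]_n) :
  row_mx x y *m hypJ *m star (row_mx x y) = y *m star x + x *m star y.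
Proof.
by rewrite mul_row_block star_row_mx mul_row_col !mulmx0 !mulmx1 add0r addr0.
Qed.

Lemma mul_star_w1 (x : 'rV[F]_n) : (x *m star w1) 0 0 = x 0 i0.
Proof.
have -> : star w1 = delta_mx i0 0.
  apply/matrixP=> i j; rewrite !mxE !ord1 eqxx andbC /=.
  by case: (i == i0); rewrite /qconj ?expr1n // expr0n gtn_eqF // ltnW.
by rewrite -colE mxE.
Qed.

Lemma mul_w1_star (x : 'rV[F]_n) : (w1 *m star x) 0 0 = cj (x 0 i0).
Proof. by rewrite -rowE !mxE. Qed.

Lemma v0_norm : v0 *m hypJ *m star v0 = 1%:M.
Proof.
rewrite row_hypJ [LHS]mx11_scalar mxE mul_w1_star mul_star_w1 mxE.
by rewrite [w1 _ _]mxE !eqxx mulr1 addrC c_trace1.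
Qed.

Lemma v0_low r : v0 *m low_unip (skew_arm_mx r) = row_mx (c *: w1 + r) w1.
Proof.
by rewrite mul_row_block !mulmx1 mulmx0 add0r mul_w1_skew.
Qed.

Lemma norm1_decomp (v : 'rV[F]_(n + n)) A : v *m hypJ *m star v = 1%:M ->
  det_in_base q A -> rsubmx v = w1 *m A ->
  exists2 r, skew_row r & v = v0 *m low_unip (skew_arm_mx r) *m levi_mx A.
Proof.
move=> v1 dA Ev; have uA := det_in_base_unit dA.
pose x := lsubmx v *m star A.
have Ev' : v = row_mx x w1 *m levi_mx A.
  by rewrite mul_row_block !mulmx0 add0r addr0 /x mulmxK ?star_unit // -Ev hsubmxK.
clearbody x.
have xw : x 0 i0 + cj (x 0 i0) = 1.
  have /andP[/eqP lA _] := lev_SU dA.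
  have : row_mx x w1 *m (levi_mx A *m hypJ *m star (levi_mx A)) *m star (row_mx x w1) = 1%:M.
    by rewrite -v1 Ev' starM !mulmxA.
  rewrite lA row_hypJ => /matrixP/(_ 0 0).
  by rewrite mxE mul_w1_star mul_star_w1 !mxE addrC.
exists (x - c *: w1); last by rewrite v0_low addrC subrK.
rewrite /skew_row !mxE !eqxx mulr1 /qconj exprDn_pchar // exprNn_pchar //.
by rewrite addrACA -opprD [X in X - _]xw [X in _ - X]c_trace1 subrr.
Qed.

Lemma norm1_rsubmx_neq0 (v : 'rV[F]_(n + n)) : v *m hypJ *m star v = 1%:M -> rsubmx v != 0.
Proof.
rewrite -(hsubmxK v) row_hypJ row_mxKr => v1; apply/eqP=> r0; move: v1.
rewrite r0 mul0mx star0 mulmx0 addr0 => /matrixP/(_ 0 0); rewrite !mxE => /eqP.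
by rewrite eq_sym oner_eq0.
Qed.

(** Commuting with the unipotents of a nonzero skew scalar [t] kills the off-diagonal blocks and
    equates the diagonal ones. Antihermitian matrices span all matrices over [F], so the remaining
    block commutes with everything. *)
Lemma central_scalar (M : 'M[F]_(n + n)) :
  (forall S, S + star S = 0 -> M *m low_unip S = low_unip S *m M /\ M *m up_unip S = up_unip S *m M) ->
  exists a, M = a%:M.
Proof.
rewrite -(submxK M); move: (ulsubmx M) (ursubmx M) (dlsubmx M) (drsubmx M) => a b d e comm.
have [t t0 ct] := exists_skew q_gt1 cardF q_pchar.
have ut : (t%:M : 'M[F]_n) \in unitmx by rewrite unitmxE det_scalar unitrX // unitfE.
have commS S : S + star S = 0 -> [/\ b *m S = 0, S *m d = 0 & e *m S = S *m a].
  move=> S0; have [] := comm S S0.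
  rewrite !mulmx_block !mul1mx !mulmx1 ?mulmx0 ?mul0mx ?addr0 ?add0r.
  move=> /eq_block_mx[E1 _ E3 _] /eq_block_mx[E1' _ _ _].
  split; first by move/eqP: E1; rewrite addrC -subr_eq0 addrK => /eqP.
    by move/eqP: E1'; rewrite eq_sym addrC -subr_eq0 addrK => /eqP.
  by apply: (addrI d); rewrite E3 addrC.
have skt : t%:M + star t%:M = 0 :> 'M_n.
  by rewrite -scalemx1 starZ star1 ct scaleNr subrr.
have [bt td et] := commS _ skt.
have b0 : b = 0 by rewrite -(mulmxK ut b) bt mul0mx.
have d0 : d = 0 by rewrite -(mulKmx ut d) td mulmx0.
have ea : e = a.
  by apply: (can_inj (mulmxK ut)); rewrite et scalar_mxC.
have commA (B : 'M_n) : a *m B = B *m a.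
  have sk x : (x *: B - cj x *: star B) + star (x *: B - cj x *: star B) = 0.
    by rewrite starB !starZ cjK starK addrA subrK subrr.
  have [x xP] := exists_qconj_neq q_gt1 cardF q_pchar 1; rewrite mul1r in xP.
  have [_ _ h1] := commS _ (sk 1); have [_ _ hx] := commS _ (sk x).
  move: h1 hx; rewrite ea /qconj expr1n -/(cj x) !scale1r => h1 hx.
  (* Two antihermitian matrices, for the scalars 1 and [x], recover a nonzero multiple of [B]. *)
  have EB : (cj x - x) *: B = cj x *: (B - star B) - (x *: B - cj x *: star B).
    by rewrite scalerBr scalerBl opprB addrA subrK.
  have : a *m ((cj x - x) *: B) = ((cj x - x) *: B) *m a.
    by rewrite EB mulmxBr mulmxBl -scalemxAr -scalemxAl h1 hx.
  rewrite -scalemxAr -scalemxAl => /(scalerI _); apply; first by rewrite subr_eq0.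
exists (a i0 i0); rewrite b0 d0 ea; suff -> : a = (a i0 i0)%:M by rewrite mxE eqxx mulr1n -scalar_mx_block.
apply/matrixP=> k i; have /matrixP/(_ k i0) := commA (delta_mx i i0).
rewrite !mxE (bigD1 i) //= !mxE !eqxx mulr1 big1 ?addr0 => [->|l li]; last first.
  by rewrite !mxE (negPf li) mulr0.
rewrite (bigD1 i0) //= !mxE eqxx andbT big1 ?addr0 => [|l li]; last first.
  by rewrite !mxE (negPf li) andbF mul0r.
by rewrite mulr_natl.
Qed.
End HyperbolicUnitary.

(** * Factorisation through the stabiliser of a vector *)

Section Factorisation.
Variables (F : finFieldType) (q n : nat).
Hypotheses (q_gt1 : (1 < q)%N) (cardF : #|F| = (q ^ 2)%N).
Hypothesis q_pchar : [pchar F].-nat q.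
Hypothesis n_gt1 : (1 < n)%N.
Variable i0 : 'I_n.
Variable c : F.
Hypothesis c_trace1 : c + qconj q c = 1.

Local Notation star := (star q).
Local Notation v0 := (v0 i0 c).
Local Notation w1 := (delta_mx 0 i0 : 'rV[F]_n).
Local Notation J := (hypJ F n).

(** An abstract copy of the hyperbolic group: [rho] may be defined beyond [G], for instance as
    conjugation by a fixed matrix on a whole general linear group. *)
Variables (gT : finGroupType) (G : {group gT}) (rho : gT -> 'M[F]_(n + n)).
Hypothesis rhoM : forall x y, rho (x * y)%g = rho x *m rho y.
Hypothesis rho_inj : injective rho.
Hypothesis memG : forall x, (x \in G) = in_SU q J (rho x).
Hypothesis rho_surj : forall M, in_SU q J M -> exists x, rho x = M.

Let in_SU1 : in_SU q J 1%:M.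
Proof. by rewrite /in_SU (star1 q_pchar) mul1mx mulmx1 det1 !eqxx. Qed.

Let rho1 : rho 1%g = 1%:M.
Proof.
have [x Ex] := rho_surj in_SU1.
suff -> : 1%g = x by [].
by apply: (mulgI x); rewrite mulg1; apply: rho_inj; rewrite rhoM Ex mulmx1.
Qed.

Let rhoX x k : rho (x ^+ k)%g = rho x ^+ k.
Proof.
elim: k => [|k IH]; first by rewrite expg0 expr0 rho1.
by rewrite expgS exprS rhoM IH.
Qed.

Let lift M : in_SU q J M -> exists2 x, x \in G & rho x = M.
Proof. by move=> sM; have [x Ex] := rho_surj sM; exists x; rewrite // memG Ex. Qed.

Definition v0_stab := [set x in G | v0 *m rho x == v0].

Fact v0_stab_group_set : group_set v0_stab.
Proof.
apply/group_setP; split; first by rewrite inE group1 rho1 mulmx1 eqxx.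
move=> x y /[!inE] /andP[xG /eqP xv] /andP[yG /eqP yv].
by rewrite groupM // rhoM mulmxA xv yv eqxx.
Qed.
Canonical v0_stab_group := Group v0_stab_group_set.

(** One unipotent element for each skew row [r]: just enough to reach each norm 1 vector with second
    component [w1] exactly once from [v0]. *)
Definition low_set := [set x in G | [exists r : 'rV[F]_n, skew_row q i0 r && (rho x == low_unip (skew_arm_mx q i0 r))]].

Let low_setP x : reflect (exists2 r : 'rV[F]_n, skew_row q i0 r & rho x = low_unip (skew_arm_mx q i0 r)) (x \in low_set).
Proof.
apply: (iffP idP); rewrite inE.
  by move=> /andP[_ /existsP[r /andP[sr /eqP Ex]]]; exists r.
move=> [r sr Ex]; rewrite memG Ex (low_SU q_pchar) ?(skewP _ cardF) //=.
by apply/existsP; exists r; rewrite sr eqxx.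
Qed.

Fact low_set_group_set : group_set low_set.
Proof.
apply/group_setP; split.
  apply/low_setP; exists 0; first exact: skew_row0.
  by rewrite (skew0 q_pchar) /low_unip -scalar_mx_block.
move=> x y /low_setP[r sr Ex] /low_setP[r' sr' Ey]; apply/low_setP.
exists (r + r'); first exact: (skew_rowD q_pchar).
by rewrite (skewD q_pchar) lowD rhoM Ex Ey.
Qed.
Canonical low_group := Group low_set_group_set.

Let low_abelian : abelian low_set.
Proof.
apply/centsP=> x /low_setP[r _ Ex] y /low_setP[r' _ Ey].
by apply: rho_inj; rewrite !rhoM Ex Ey -!lowD addrC.
Qed.

Let low_setS : low_set \subset G. Proof. by apply/subsetP=> x /[!inE]/andP[]. Qed.
Let v0_stabS : v0_stab \subset G. Proof. by apply/subsetP=> x /[!inE]/andP[]. Qed.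

Lemma v0_transitive (v : 'rV[F]_(n + n)) : v *m J *m star v = 1%:M ->
  exists2 x, x \in G & v = v0 *m rho x.
Proof.
move=> v1; have vr := norm1_rsubmx_neq0 q_pchar v1.
have [a [b [X [S [Y [_ [dX dS dY Y1] _ gen]]]]]] := levi_factors q_gt1 cardF n_gt1 (w1_neq0 F i0).
have [j [i [k Ev]]] := gen _ vr.
have dA : det_in_base q (X ^+ j *m Y i *m S ^+ k) by rewrite !det_in_baseM ?det_in_baseX.
have [|r sr ->] := norm1_decomp (i0 := i0) q_gt1 cardF q_pchar c_trace1 v1 dA.
  by rewrite Ev !mulmxA.
have [x xG Ex] := lift (low_SU q_pchar (skewP q_gt1 cardF q_pchar sr)).
have [y yG Ey] := lift (lev_SU cardF q_pchar dA).
by exists (x * y)%g; rewrite ?groupM // rhoM Ex Ey mulmxA.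
Qed.

Lemma center_quotient_has_MLS : covers v0_stab v0_stab #|v0_stab| ->
  has_MLS (G / 'Z(G))%g.
Proof.
move=> cov0.
have [a [b [X [S [Y [[ab bP] [dX dS dY Y1] [SN Sc] gen]]]]]] :=
  levi_factors q_gt1 cardF n_gt1 (w1_neq0 F i0).
set N := (q ^ (2 * n)).-1 in SN.
have [gX gXG EX] := lift (lev_SU cardF q_pchar dX).
have [gS gSG ES] := lift (lev_SU cardF q_pchar dS).
have /fin_all_exists[gY gYP] : forall i, exists y, y \in G /\ rho y = levi_mx q (Y i).
  by move=> i; have [y] := lift (lev_SU cardF q_pchar (dY i)); exists y.
have uP A := @det_in_base_unit F q n A.
have EA j i k : rho (gX ^+ j * gY i * gS ^+ k)%g = levi_mx q (X ^+ j *m Y i *m S ^+ k).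
  rewrite !rhoM !rhoX EX ES (gYP i).2 -!(levX q_pchar) ?uP //.
  by rewrite -!(levM q_pchar) // ?unitmx_mul ?uP // ?det_in_baseX.
pose IX := [set gX ^+ j | j : 'I_a]%g; pose IY := [set gY i | i : 'I_b].
have cover_G : G \subset (v0_stab * low_set * IX * IY * <[gS]>)%g.
  apply/subsetP=> g gG; pose v := v0 *m rho g.
  have v1 : v *m J *m star v = 1%:M.
    move: gG; rewrite memG => /andP[/eqP gJ _].
    rewrite -(v0_norm q_gt1 i0 c_trace1) -{2}gJ (starM q_pchar) !mulmxA //.
  have vr := norm1_rsubmx_neq0 q_pchar v1.
  have [j [i [k Ev]]] := gen _ vr.
  have dA : det_in_base q (X ^+ j *m Y i *m S ^+ k) by rewrite !det_in_baseM ?det_in_baseX.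
  have [|r sr Ev'] := norm1_decomp (i0 := i0) q_gt1 cardF q_pchar c_trace1 v1 dA.
    by rewrite Ev !mulmxA.
  have [x xG Ex] := lift (low_SU q_pchar (skewP q_gt1 cardF q_pchar sr)).
  have [y Ey] : exists y, y = (gX ^+ j * gY i * gS ^+ k)%g by eexists.
  have yG : y \in G by rewrite Ey !groupM ?groupX // (gYP i).1.
  have hS : (g * (x * y)^-1)%g \in v0_stab.
    rewrite inE groupM ?groupV ?groupM //=; apply/eqP.
    rewrite -[in RHS](mulmx1 v0) -rho1 -(mulgV (x * y)%g) !rhoM !mulmxA -/v Ev' Ex.
    by rewrite -EA -Ey.
  have -> : g = (g * (x * y)^-1 * x * gX ^+ j * gY i * gS ^+ k)%g.
    by rewrite -[LHS](mulgKV (x * y)%g) Ey !mulgA.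
  apply: mem_mulg (mem_cycle _ _); apply: mem_mulg (imset_f _ _) => //.
  apply: mem_mulg; last by apply/imsetP; exists j.
  apply: mem_mulg => //.
  by apply/low_setP; exists r.
have ZS : ('Z(G) \subset <[gS]>)%g.
  apply/subsetP=> z /centerP[zG zC].
  have [t Et] : exists t, rho z = t%:M.
    apply: (central_scalar q_gt1 cardF q_pchar i0) => T T0.
    have [x xG <-] := lift (low_SU q_pchar T0); have [y yG <-] := lift (up_SU q_pchar T0).
    by rewrite -!rhoM; split; congr rho; apply: zC.
  move: (zG); rewrite memG Et => /andP[/eqP tJ /eqP dt].
  have tt : t * qconj q t = 1.
    have J0 : J (lshift n i0) (rshift n i0) = 1 by rewrite block_mxEur !mxE eqxx.
    have Est : star t%:M = (qconj q t)%:M :> 'M_(n + n).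
      by rewrite -scalemx1 (starZ q_pchar) (star1 q_pchar) scalemx1.
    move/matrixP/(_ (lshift n i0) (rshift n i0)): tJ.
    by rewrite Est mul_scalar_mx mul_mx_scalar scalerA mxE J0 mulr1 mulrC.
  (* Preservation of the form gives [t ^+ q.+1 = 1], and determinant 1 gives [t ^+ (2 * n) = 1]. *)
  have [||k Ek] := Sc t.
  - by rewrite exprS -/(qconj q t).
  - by move: dt; rewrite det_scalar addnn mul2n.
  have -> : z = (gS ^+ k)%g by apply: rho_inj; rewrite rhoX ES -(levX q_pchar) ?uP // Ek (lev_scalar _ q_pchar).
  exact: mem_cycle.
have N0 : (0 < N)%N.
  by rewrite /N -ltnS prednK ?expn_gt0 ?(ltnW q_gt1) // expn_gt1 // muln_gt0 (ltnW n_gt1).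
have oS : (#|<[gS]>%g| * q.+1 <= N)%N.
  have qN : (q.+1 %| N)%N by apply: dvdn_succ_card; apply: ltnW.
  rewrite -[X in (_ <= X)%N](divnK qN) leq_pmul2r //; apply: dvdn_leq.
    by rewrite divn_gt0 // dvdn_leq.
  rewrite -orderE order_dvdn; apply/eqP/rho_inj.
  by rewrite rhoX ES -(levX q_pchar) ?uP // SN (lev1 _ q_pchar).
(* A lower bound for the order of [G], by an injection into it: the image of [v0] determines the
   nonzero vector [y] and then the row [r], and the stabiliser element is what remains. *)
have card_G : (#|v0_stab| * #|low_set| * N <= #|G|)%N.
  (* [L y] is a chosen Levi element carrying [w1] to [y]; its value at 0 is a dummy. *)
  have /fin_all_exists[L LP] : forall y : 'rV[F]_n, exists x, y != 0 ->
      x \in G /\ exists2 A, det_in_base q A & rho x = levi_mx q A /\ w1 *m A = y.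
    move=> y; have [-> | y0] := eqVneq y 0; first by exists 1%g.
    have [j [i [k Ey]]] := gen _ y0; exists (gX ^+ j * gY i * gS ^+ k)%g => _.
    split; first by rewrite !groupM ?groupX // (gYP i).1.
    exists (X ^+ j *m Y i *m S ^+ k); first by rewrite !det_in_baseM ?det_in_baseX.
    by rewrite EA Ey !mulmxA.
  pose D := setX (setX v0_stab low_set) [set~ (0 : 'rV[F]_n)].
  pose f (t : gT * gT * 'rV[F]_n) := (t.1.1 * t.1.2 * L t.2)%g.
  have -> : (#|v0_stab| * #|low_set| * N)%N = #|D|.
    by rewrite !cardsX cardsC1 card_mx mul1n cardF -expnM.
  have v0f t : t \in D -> exists r A, [/\ det_in_base q A, rho (t.1.2) = low_unip (skew_arm_mx q i0 r),
      v0 *m rho (f t) = row_mx (c *: w1 + r) w1 *m levi_mx q A,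
      rho (L t.2) = levi_mx q A & w1 *m A = t.2].
    case: t => [[h u] y]; rewrite !inE /= => /andP[/andP[]].
    move=> /andP[_ /eqP hv] /andP[_ /existsP[r /andP[_ /eqP Eu]]] y0.
    have [_ [A dA [EL wA]]] := LP y y0; exists r, A; split=> //.
    by rewrite /f /= !rhoM !mulmxA hv Eu EL v0_low.
  have injf : {in D &, injective f}.
    move=> t t' tD tD' Ef.
    have [r [A [dA Er Ev EL wA]]] := v0f t tD; have [r' [A' [dA' Er' Ev' EL' wA']]] := v0f t' tD'.
    have Ey : t.2 = t'.2.
      have : rsubmx (v0 *m rho (f t)) = rsubmx (v0 *m rho (f t')) by rewrite Ef.
      by rewrite Ev Ev' !mul_row_block !mulmx0 !add0r !row_mxKr wA wA'.
    have EA' : levi_mx q A = levi_mx q A' by rewrite -EL -EL' Ey.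
    have uA : levi_mx q A \in unitmx.
      have /andP[_ /eqP d1] := lev_SU cardF q_pchar dA.
      by rewrite unitmxE d1 unitr1.
    have Er2 : r = r'.
      have : v0 *m rho (f t) = v0 *m rho (f t') by rewrite Ef.
      rewrite Ev Ev' -EA' => /(can_inj (mulmxK uA))/eq_row_mx[+ _]; exact: addrI.
    have Eu : t.1.2 = t'.1.2 by apply: rho_inj; rewrite Er Er' Er2.
    move: Ef; rewrite /f Ey Eu -!mulgA => /mulIg.
    by case: t t' Ey Eu {tD tD' Er Er' Ev Ev' EL EL' wA wA'} => [[h u] y] [[h' u'] y'] /= -> -> ->.
  rewrite -(card_in_imset injf) subset_leq_card //; apply/subsetP=> _ /imsetP[t tD ->].
  case: t tD => [[h u] y]; rewrite !inE /f /= => /andP[/andP[]].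
  move=> /andP[hG _] /andP[uG _] y0; have [LG _] := LP y y0.
  by rewrite !groupM.
have nZ : G \subset 'N('Z(G))%g := normal_norm (center_normal G).
have [a0 b0] : (0 < a)%N /\ (0 < b)%N by apply/andP; rewrite -muln_gt0 ab.
have cov : covers G (v0_stab * low_set * IX * IY)%g (#|v0_stab| * #|low_set| * a * b).
  apply: covers_mul; first apply: covers_mul; first apply: covers_mul.
  - exact: covers_weaken cov0.
  - by apply: covers_solvable; rewrite ?abelian_sol.
  - exact: covers_interval.
  have IYG : IY \subset G by apply/subsetP=> _ /imsetP[i _ ->]; rewrite (gYP i).1.
  have cIY : (#|IY| <= b)%N by rewrite (leq_trans (leq_imset_card _ _)) ?card_ord.
  (* For [b = 1] the set [IY] consists of the identity alone and is absorbed by the empty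
     product. *)
  case: bP => [b1 | prb]; last exact: covers_prime.
  apply: covers_sub (_ : covers G 1%g b); last by rewrite b1; apply: covers1.
  apply/subsetP=> _ /imsetP[i _ ->]; rewrite inE; apply/eqP/rho_inj.
  by rewrite (gYP i).2 Y1 ?(lev1 _ q_pchar) //; move: (ltn_ord i); rewrite {2}b1; case: (nat_of_ord i).
(* The image of the cyclic factor is decomposed afresh in the quotient. It contributes the whole
   saving by the order of the centre, while the other factors keep their bounds. *)
have covS : covers (G / 'Z(G))%g (<[gS]> / 'Z(G))%g #|<[gS]> / 'Z(G)|%g.
  apply: covers_solvable; first by rewrite quotientS // cycle_subG.
  by rewrite quotient_sol // abelian_sol // cycle_abelian.
have AN : (v0_stab * low_set * IX * IY \subset 'N('Z(G)))%g.
  rewrite !mul_subG // (subset_trans _ nZ) //; apply/subsetP=> _ /imsetP[i _ ->].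
    by rewrite groupX.
  by rewrite (gYP i).1.
apply: (covers_has_MLS (N := #|v0_stab| * #|low_set| * a * b * #|<[gS]> / 'Z(G)|%g)).
  apply: covers_sub (covers_mul (covers_morphim nZ (subxx _) cov) covS).
  by rewrite -morphimMl // morphimS.
have cardQ (K : {group gT}) : 'Z(G)%g \subset K -> K \subset G ->
    (#|(K / 'Z(G))%g| * #|'Z(G)%g|)%N = #|K|.
  by move=> ZK KG; rewrite card_quotient ?(subset_trans KG) // mulnC Lagrange.
(* Multiplying by the order of the centre reduces the comparison to [card_G] and [oS], using
   [a * b = q.+1]. *)
rewrite -(leq_pmul2r (cardG_gt0 'Z(G)%G)) cardQ ?center_sub // -mulnA cardQ ?cycle_subG //.
rewrite (leq_trans _ card_G) // -!mulnA !leq_mul2l mulnA ab mulnC oS !orbT //.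
Qed.
Lemma hypJ_nonsing : \det J != 0.
Proof.
have JJ : J *m J = 1%:M.
  rewrite mulmx_block !mulmx0 !mul0mx !mulmx1 !addr0 !add0r; exact: esym (scalar_mx_block _ _ _).
apply/eqP=> J0; have := congr1 determinant JJ.
by rewrite det_mulmx J0 mul0r det1 => /eqP; rewrite eq_sym oner_eq0.
Qed.

(** Congruence of forms and transitivity on norm 1 vectors give a matrix [Q] taking [D] to the
    hyperbolic form and [e0] to [v0]; conjugation by it identifies [K] with [v0_stab]. *)
Lemma stab_has_MLS (gT1 : finGroupType) (K : {group gT1}) (sigma : gT1 -> 'M[F]_(n + n))
    (D : 'M[F]_(n + n)) (e0 : 'rV[F]_(n + n)) :
  {in K &, forall x y, sigma (x * y)%g = sigma x *m sigma y} ->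
  {in K &, injective sigma} ->
  star D = D -> \det D != 0 -> e0 *m D *m star e0 = 1%:M ->
  (forall h, h \in K -> in_SU q D (sigma h) /\ e0 *m sigma h = e0) ->
  (forall M, in_SU q D M -> e0 *m M = e0 -> exists2 h, h \in K & M = sigma h) ->
  has_MLS K -> has_MLS (G / 'Z(G))%g.
Proof.
move=> sM sI hD dD e0D sK sS mlsK.
have hJ : star J = J by exact: star_hypJ.
have [Q0 uQ0 EQ0] := herm_congr q_gt1 cardF q_pchar hJ hypJ_nonsing hD dD.
have v1 : (e0 *m Q0) *m J *m star (e0 *m Q0) = 1%:M.
  by rewrite -e0D -EQ0 (starM q_pchar) !mulmxA.
have [g gG Eg] := v0_transitive v1.
(* [Q0] matches the forms only; the isometry [rho g^-1] then moves [e0 *m Q0] to [v0]. *)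
pose Q := Q0 *m rho g^-1%g.
have EQ : Q *m J *m star Q = D.
  have : g^-1%g \in G by rewrite groupV.
  rewrite memG => /andP[/eqP gJ _]; rewrite -EQ0 -[in RHS]gJ /Q (starM q_pchar) !mulmxA //.
have e0Q : e0 *m Q = v0 by rewrite mulmxA Eg -mulmxA -rhoM mulgV rho1 mulmx1.
have uQ : Q \in unitmx.
  rewrite unitmx_mul uQ0 /=; have : g^-1%g \in G by rewrite groupV.
  by rewrite memG unitmxE => /andP[_ /eqP->]; rewrite unitr1.
clearbody Q.
have DQ M : in_SU q D M = in_SU q J (invmx Q *m M *m Q).
  have EM : Q *m (invmx Q *m M *m Q *m J *m star (invmx Q *m M *m Q)) *m star Q = M *m D *m star M.
    rewrite -EQ !(starM q_pchar) (star_inv q_pchar) !mulmxA mulmxV // mul1mx.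
    by rewrite mulmxKV // star_unit.
  rewrite /in_SU; congr (_ && _).
    apply/eqP/eqP=> E.
      apply: (can_inj (mulKmx uQ)); apply: (can_inj (mulmxK (_ : star Q \in unitmx))).
        by rewrite star_unit.
      by rewrite EM E EQ.
    by rewrite -EM E EQ.
  by rewrite -{2}(invmxK Q) det_conj ?unitmx_inv.
(* Outside [K] the value of [phi] is a dummy, chosen to be 1. *)
have /fin_all_exists[phi phiP] : forall h, exists x, h \in K -> rho x = invmx Q *m sigma h *m Q.
  move=> h; have [hK | _] := boolP (h \in K); last by exists 1%g.
  have [sh _] := sK h hK; rewrite DQ in sh.
  by have [x Ex] := rho_surj sh; exists x.
have phiM : {in K &, {morph phi : x y / (x * y)%g}}.
  move=> x y xK yK; apply: rho_inj; rewrite rhoM !phiP ?groupM // sM //.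
  by rewrite !mulmxA mulmxK.
pose f := Morphism phiM.
have injf : ('injm f)%g.
  apply/injmP=> x y xK yK Exy; apply: sI => //.
  have : rho (phi x) = rho (phi y) by congr rho.
  by rewrite !phiP // => /(can_inj (mulmxK uQ)); apply: (can_inj (mulKVmx uQ)).
have imf : (f @* K = v0_stab)%g.
  apply/setP=> x; rewrite inE memG; apply/morphimP/andP.
    move=> [h _ hK ->]; have [sh eh] := sK h hK.
    rewrite /= phiP // -DQ; split=> //; apply/eqP.
    by rewrite -e0Q !mulmxA mulmxK // eh.
  move=> [xJ /eqP xv].
  have EQx : rho x = invmx Q *m (Q *m rho x *m invmx Q) *m Q.
    by rewrite -!mulmxA mulVmx // mulmx1 mulKmx.
  have [h hK Eh] : exists2 h, h \in K & Q *m rho x *m invmx Q = sigma h.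
    apply: sS; first by rewrite DQ -EQx.
    by rewrite !mulmxA e0Q xv -e0Q mulmxK.
  by exists h => //=; apply: rho_inj; rewrite phiP // -Eh.
apply: center_quotient_has_MLS; rewrite -imf card_injm //.
by apply: covers_morphim (has_MLS_covers (subxx _) mlsK).
Qed.
End Factorisation.

(** * Transfer to the groups SU and PSU *)

Section GeneralLinear.
Variables (F : finFieldType) (q m : nat).
Hypothesis q_pchar : [pchar F].-nat q.
Local Notation star := (star q).

Lemma GLvalM (x y : {'GL_m[F]}) : GLval (x * y)%g = GLval x *m GLval y.
Proof. by []. Qed.

Lemma mem_SU (H : 'M[F]_m.-1.+1) (x : {'GL_m[F]}) : (x \in SU m q H) = in_SU q H (GLval x).
Proof. by rewrite inE. Qed.

Lemma GL_surj (M : 'M[F]_m.-1.+1) : M \in unitmx -> exists x : {'GL_m[F]}, GLval x = M.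
Proof. by move=> uM; exists (Sub M uM). Qed.

Lemma SU_group_set (H : 'M[F]_m.-1.+1) : group_set (SU m q H).
Proof.
apply/group_setP; split.
  by rewrite mem_SU /in_SU /= (star1 q_pchar) mul1mx mulmx1 det1 !eqxx.
move=> x y; rewrite !mem_SU /in_SU GLvalM => /andP[/eqP xH /eqP dx] /andP[/eqP yH /eqP dy].
rewrite det_mulmx dx dy mulr1 eqxx andbT; apply/eqP.
rewrite (starM q_pchar); transitivity (GLval x *m (GLval y *m H *m star (GLval y)) *m star (GLval x)).
  by rewrite !mulmxA.
by rewrite yH.
Qed.

End GeneralLinear.

(** * The smaller unitary group as the stabiliser of a norm 1 vector *)

Lemma block1M (R : comNzRingType) k (g h : 'M[R]_k) :
  block_mx (1%:M : 'M_1) 0 0 (g *m h) = block_mx 1%:M 0 0 g *m block_mx 1%:M 0 0 h.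
Proof.
by rewrite mulmx_block ?(mul1mx, mulmx1, mul0mx, mulmx0, addr0, add0r).
Qed.

Lemma block1_inj (R : comNzRingType) k :
  injective (fun h : 'M[R]_k => block_mx (1%:M : 'M_1) 0 0 h).
Proof. by move=> g h /eq_block_mx[]. Qed.

Section SpecialUnitaryBlock.
Variables (F : finFieldType) (q k : nat).
Hypothesis q_pchar : [pchar F].-nat q.
Local Notation star := (star q).
Variable H1 : 'M[F]_k.

Let D : 'M[F]_(1 + k) := block_mx 1%:M 0 0 H1.
Let e0 : 'rV[F]_(1 + k) := row_mx 1%:M 0.

Lemma block1_SU h : in_SU q H1 h -> in_SU q D (block_mx 1%:M 0 0 h).
Proof.
move=> /andP[/eqP hH /eqP dh]; rewrite /in_SU det_ublock det1 mul1r dh eqxx andbT.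
rewrite star_block (star1 q_pchar) !(star0 q_pchar) !mulmx_block.
by rewrite !mul1mx !mul0mx !mulmx1 !mulmx0 !addr0 !add0r mul0mx hH.
Qed.

Lemma row_e0_block1 (h : 'M[F]_k) : e0 *m block_mx 1%:M 0 0 h = e0.
Proof. by rewrite mul_row_block !mulmx0 !mul0mx mulmx1 !addr0. Qed.

Lemma e0_block_norm : e0 *m D *m star e0 = 1%:M.
Proof.
by rewrite row_e0_block1 star_row_mx (star1 q_pchar) (star0 q_pchar) mul_row_col mulmx1 mulmx0 addr0.
Qed.

Lemma star_block1 : star H1 = H1 -> star D = D.
Proof. by move=> hH; rewrite star_block (star1 q_pchar) !(star0 q_pchar) hH. Qed.

Lemma det_block1 : \det D = \det H1.
Proof. by rewrite det_ublock det1 mul1r. Qed.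

(** Fixing [e0] determines the first row of [M]; the off-diagonal blocks of the isometry equation
    then make the rest of the first column vanish, so the orthogonal complement is preserved. *)
Lemma stab_e0_block1 M : in_SU q D M -> e0 *m M = e0 ->
  exists2 h, in_SU q H1 h & M = block_mx 1%:M 0 0 h.
Proof.
move=> /andP[/eqP MD /eqP dM] eM.
have EM : M = block_mx 1%:M 0 (dlsubmx M) (drsubmx M).
  rewrite -{1}(submxK M); move: eM; rewrite -{1}(submxK M) mul_row_block.
  by rewrite !mul1mx !mul0mx !addr0 => /eq_row_mx[-> ->].
move: MD dM; rewrite EM; move: (dlsubmx M) (drsubmx M) => b h.
rewrite det_lblock det1 mul1r star_block (star1 q_pchar) !(star0 q_pchar) !mulmx_block.
rewrite !mul1mx !mul0mx ?mulmx1 ?mulmx0 ?addr0 ?add0r ?mul1mx ?mul0mx ?addr0 ?mulmx1 ?mulmx0 ?addr0.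
move=> /eq_block_mx[_ _ b0 hH] dh; rewrite b0.
exists h => //; rewrite /in_SU dh eqxx andbT -{2}hH b0.
by rewrite mul0mx add0r.
Qed.
End SpecialUnitaryBlock.

(** With the dimensions written as these sums, [1 + (n.+1 + n.+2)] and [n.+2 + n.+2] are
    convertible, and so are a dimension and its [.-1.+1]. *)
Lemma PSU_even_has_MLS (F : finFieldType) (q n : nat)
    (H1 : 'M[F]_((n.+1 + n.+2).-1.+1)) (H2 : 'M[F]_((n.+2 + n.+2).-1.+1)) :
  (1 < q)%N -> #|F| = (q ^ 2)%N -> [pchar F].-nat q ->
  nonsing_herm q H1 -> nonsing_herm q H2 ->
  has_MLS (SU (n.+1 + n.+2) q H1) -> has_MLS (PSU (n.+2 + n.+2) q H2).
Proof.
move=> q1 cardF q_pchar /nonsing_hermP[hH1 dH1] /nonsing_hermP[hH2 dH2] mls1.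
pose K := Group (SU_group_set q_pchar H1); pose G := Group (SU_group_set q_pchar H2).
have [c c_tr] := exists_trace1 q1 cardF q_pchar.
have [P uP EP] := herm_congr q1 cardF q_pchar hH2 dH2
  (star_hypJ n.+2 q_pchar) (hypJ_nonsing F n.+2).
pose rho (x : {'GL_(n.+2 + n.+2)[F]}) : 'M[F]_(n.+2 + n.+2) := P *m GLval x *m invmx P.
have rhoM x y : rho (x * y)%g = rho x *m rho y.
  by rewrite /rho GLvalM !mulmxA mulmxKV.
have rho_inj : injective rho.
  move=> x y /(can_inj (mulmxKV uP))/(can_inj (mulKmx uP)); exact: val_inj.
have in_SU_conj M : in_SU q H2 M = in_SU q (hypJ F n.+2) (P *m M *m invmx P).
  rewrite /in_SU -EP det_conj //; congr (_ && _).
  have -> : P *m M *m invmx P *m (P *m H2 *m star q P) *m star q (P *m M *m invmx P) =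
      P *m (M *m H2 *m star q M) *m star q P.
    rewrite !(starM q_pchar) (star_inv q_pchar) !mulmxA mulmxKV // mulmxK ?star_unit //.
  apply/eqP/eqP=> [-> // | /(can_inj (mulmxK _))E].
  by apply: (can_inj (mulKmx uP)); apply: E; rewrite star_unit.
have memG x : (x \in G) = in_SU q (hypJ F n.+2) (rho x).
  by rewrite -in_SU_conj -mem_SU.
have rho_surj M : in_SU q (hypJ F n.+2) M -> exists x, rho x = M.
  move=> /andP[_ /eqP dM].
  have uM : invmx P *m M *m P \in unitmx.
    by rewrite !unitmx_mul unitmx_inv uP unitmxE dM unitr1.
  have [x Ex] := @GL_surj F (n.+2 + n.+2) _ uM; exists x; rewrite /rho Ex.
  by rewrite !mulmxA mulmxV // mul1mx mulmxK.
pose sigma (h : {'GL_(n.+1 + n.+2)[F]}) : 'M[F]_(n.+2 + n.+2) := block_mx (1%:M : 'M_1) 0 0 (GLval h).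
apply: (stab_has_MLS q1 cardF q_pchar (isT : (1 < n.+2)%N) ord0 c_tr rhoM rho_inj memG rho_surj
  (K := K) (sigma := sigma) _ _ (star_block1 q_pchar hH1) _ (e0_block_norm q_pchar H1)).
- by move=> x y _ _; apply: (block1M (GLval x) (GLval y)).
- by move=> x y _ _ Exy; apply/val_inj/(block1_inj Exy).
- by rewrite det_block1.
- move=> h; rewrite mem_SU => hK; split; last exact: row_e0_block1.
  exact: block1_SU.
- move=> M MD eM; have [h hH EM] := stab_e0_block1 q_pchar MD eM.
  have [x Ex] : exists x : {'GL_(n.+1 + n.+2)[F]}, GLval x = h.
    by apply: GL_surj; have /andP[_ /eqP dh] := hH; rewrite unitmxE dh unitr1.
  by exists x; rewrite ?mem_SU ?Ex // EM /sigma Ex.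
exact: mls1.
Qed.

Local Close Scope ring_scope.

Theorem theorem4p1 (q n : nat) (F : finFieldType)
    (H1 : 'M[F]_((2 * n - 1).-1.+1)) (H2 : 'M[F]_((2 * n).-1.+1)) :
  (exists p k : nat, [/\ prime p, (0 < k)%N & q = p ^ k]) ->
  (2 <= n)%N ->
  #|F| = (q ^ 2)%N ->
  nonsing_herm q H1 -> nonsing_herm q H2 ->
  has_MLS (SU (2 * n - 1) q H1) -> has_MLS (PSU (2 * n) q H2).
Proof.
move=> [p [k [pr k_gt0 Eq]]] n_gt1 cardF.
have q_gt1 : (1 < q)%N by rewrite Eq expn_gt1 // prime_gt1.
have p_pchar : p \in [pchar F]%R.
  by apply: (@card_finPcharP F p (k * 2)); rewrite // cardF Eq -expnM.
have q_pchar : ([pchar F]%R).-nat q by rewrite Eq pnatX pnatE // p_pchar.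
case: n n_gt1 H1 H2 => [|[|n]] // _.
(* The sizes are rewritten while the Gram matrices, whose types depend on them, are still quantified
   in the goal. *)
have -> : (2 * n.+2 - 1 = n.+1 + n.+2)%N by lia.
have -> : (2 * n.+2 = n.+2 + n.+2)%N by lia.
by move=> H1 H2; apply: PSU_even_has_MLS.
Qed.
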